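(* Let $\beta\in(0,1)$, $\sigma>0$ and $k\in\{1,\ldots,d\}$ be fixed numbers, let $d=d_\varepsilon\to\infty$ as $\varepsilon\to0$, and let $$\log\binom{d}{k}=o\left(\varepsilon^{-2k/(2\sigma+k)}\right),\quad \varepsilon\to0.$$ Assume that the family $r_{\varepsilon,k}>0$ is such that (for an arbitrary $u_k\in\mathcal U_{k,d}$) $$\limsup_{\varepsilon\to0}\frac{a_{\varepsilon,u_k}(r_{\varepsilon,k})}{\sqrt{2\log\binom{d}{k}}}<\sqrt{\beta}.$$ Then $$\liminf_{\varepsilon\to0}\ \inf_{\tilde{\boldsymbol\eta}_k}\ \sup_{\boldsymbol\eta_k\in H^k_{\beta,d}}\ \sup_{\boldsymbol\theta_k\in\mathring\Theta^\sigma_{k,d}(r_{\varepsilon,k})}\binom{d}{k}^{\beta-1}\mathrm E_{\boldsymbol\theta_k,\boldsymbol\eta_k}|\tilde{\boldsymbol\eta}_k-\boldsymbol\eta_k|>0,$$ where the infimum is over all selectors $\tilde{\boldsymbol\eta}_k=(\tilde\eta_{u_k})_{u_k\in\mathcal U_{k,d}}$, i.e. all $\{0,1\}^{\binom dk}$-valued estimators based on the data $\{X_{\boldsymbol\ell}:\boldsymbol\ell\in\mathring{\mathbb Z}_{u_k},\,u_k\in\mathcal U_{k,d}\}$.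
   Context: Index sets. $\mathcal U_{k,d}$ is the set of all subsets $u_k\subseteq\{1,\ldots,d\}$ with $k$ elements. For $u_k\in\mathcal U_{k,d}$, $\mathring{\mathbb Z}_{u_k}=\{\boldsymbol\ell=(l_1,\ldots,l_d)\in\mathbb Z^d:\ l_j=0 \text{ for } j\notin u_k,\ l_j\ne0\text{ for }j\in u_k\}$. Sparsity class. $H^k_{\beta,d}=H^k_{\beta,d}(\varepsilon)$ is the set of $\boldsymbol\eta_k=(\eta_{u_k})_{u_k\in\mathcal U_{k,d}}$ with $\eta_{u_k}\in\{0,1\}$ and $\sum_{u_k\in\mathcal U_{k,d}}\eta_{u_k}=\binom dk^{1-\beta}(1+o(1))$ as $\varepsilon\to0$. The $o(1)$ is uniform: membership means $|\binom dk^{\beta-1}\sum\eta_{u_k}-1|\le\delta_\varepsilon$ for a fixed family $\delta_\varepsilon\to0$, large enough that all vectors with exactly $[\binom dk^{1-\beta}]$ ones (integer part) are included; one may think of the number of ones as being this integer part. Ellipsoids. $c_{\boldsymbol\ell}^2=\big(\sum_{j=1}^d(2\pi l_j)^2\big)^\sigma$. For $r>0$, $\mathring\Theta_{\mathbf c_{u_k}}(r)$ is the set of real families $\boldsymbol\theta_{u_k}=(\theta_{\boldsymbol\ell}(u_k))_{\boldsymbol\ell\in\mathring{\mathbb Z}_{u_k}}$ with $\sum_{\boldsymbol\ell}\theta_{\boldsymbol\ell}^2(u_k)c_{\boldsymbol\ell}^2\le1$ and $\sum_{\boldsymbol\ell}\theta_{\boldsymbol\ell}^2(u_k)\ge r^2$.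 $\mathring\Theta^\sigma_{k,d}(r)$ is the set of $\boldsymbol\theta_k=(\boldsymbol\theta_{u_k})_{u_k\in\mathcal U_{k,d}}$ with $\boldsymbol\theta_{u_k}\in\mathring\Theta_{\mathbf c_{u_k}}(r)$ for every $u_k$. Standing convention: $r_{\varepsilon,k}\in(0,(2\pi)^{-\sigma}k^{-\sigma/2})$ (for larger radii the set is empty). Model. For noise level $\varepsilon>0$ one observes $X_{\boldsymbol\ell}=\eta_{u_k}\theta_{\boldsymbol\ell}(u_k)+\varepsilon\xi_{\boldsymbol\ell}$, $\boldsymbol\ell\in\mathring{\mathbb Z}_{u_k}$, $u_k\in\mathcal U_{k,d}$, where all $\xi_{\boldsymbol\ell}$ are i.i.d. $N(0,1)$. $\mathrm E_{\boldsymbol\theta_k,\boldsymbol\eta_k}$ is the expectation under this model. For $\{0,1\}$-valued vectors, $|\boldsymbol\eta-\boldsymbol\eta'|=\sum_{u_k\in\mathcal U_{k,d}}|\eta_{u_k}-\eta'_{u_k}|$ (Hamming distance). Detection function. $a_{\varepsilon,u_k}(r)\ge0$ is given by $$a^2_{\varepsilon,u_k}(r)=\frac1{2\varepsilon^4}\inf_{\boldsymbol\theta_{u_k}\in\mathring\Theta_{\mathbf c_{u_k}}(r)}\sum_{\boldsymbol\ell\in\mathring{\mathbb Z}_{u_k}}\theta_{\boldsymbol\ell}(u_k)^4;$$ it depends on $u_k$ only through $k$. *)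

(* Defs.v *)
From HB Require Import structures.
From mathcomp Require Export all_boot all_order all_algebra.
From mathcomp Require Export all_classical all_reals all_analysis.
Set Implicit Arguments.
Unset Strict Implicit.
Unset Printing Implicit Defensive.

Import Order.TTheory GRing.Theory Num.Theory.
Import numFieldNormedType.Exports.
Local Open Scope classical_set_scope.
Local Open Scope ring_scope.

(* Subsets of {1, ..., d} are subsets of 'I_d: indices are shifted by one. *)
Definition kset (d k : nat) := {u : {set 'I_d} | #|u| == k}.

Definition freq (d : nat) (u : {set 'I_d}) :=
  {l : {ffun 'I_d -> int} | [forall j, (l j != 0) == (j \in u)]}.

(* Since freq u and freq v are disjoint for u != v, the index of an observation
   determines its k-set; here the k-set is carried along as the tag. *)
Definition obs_index (d k : nat) := {u : kset d k & freq (val u)}.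

Definition parameter (R : realType) (d k : nat) :=
  forall u : kset d k, freq (val u) -> R.

Definition sample (R : realType) (d k : nat) := obs_index d k -> R.

Section ellipsoids.
Variables (R : realType) (sigma : R).

Definition ellipsoid_coef2 (d : nat) (l : {ffun 'I_d -> int}) : R :=
  (\sum_(j < d) (2 * pi * (l j)%:~R) ^+ 2) `^ sigma.

Definition ellipsoid (d : nat) (u : {set 'I_d}) (r : R) : set (freq u -> R) :=
  [set theta |
    (\esum_(l in [set: freq u])
       (theta l ^+ 2 * ellipsoid_coef2 (val l))%:E <= 1)%E /\
    ((r ^+ 2)%:E <= \esum_(l in [set: freq u]) (theta l ^+ 2)%:E)%E].

Definition ellipsoids (d k : nat) (r : R) : set (parameter R d k) :=
  [set theta | forall u : kset d k, ellipsoid r (theta u)].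

(* Extended-real valued, because the infimum over the empty set is +oo;
   it is finite as soon as the ellipsoid is nonempty. *)
Definition detection2 (d : nat) (u : {set 'I_d}) (eps r : R) : \bar R :=
  ((2 * eps ^+ 4)^-1%:E *
   ereal_inf [set (\esum_(l in [set: freq u]) (theta l ^+ 4)%:E)%E
             | theta in @ellipsoid d u r])%E.

Definition detection (d : nat) (u : {set 'I_d}) (eps r : R) : \bar R :=
  poweR (detection2 u eps r) 2^-1.

End ellipsoids.

Section sparsity_and_loss.
Variables (d k : nat).

Definition nactive (eta : {ffun kset d k -> bool}) : nat :=
  \sum_(u : kset d k) eta u.

Definition hamming (eta eta' : {ffun kset d k -> bool}) : nat :=
  \sum_(u : kset d k) (eta u != eta' u).

(* delta is the value at the given noise level of the rate that makes the
   o(1) term uniform. *)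
Definition sparsity_class (R : realType) (beta delta : R) :
    set {ffun kset d k -> bool} :=
  [set eta | `| 'C(d, k)%:R `^ (beta - 1) * (nactive eta)%:R - 1 | <= delta].

End sparsity_and_loss.

Definition mutually_independent (R : realType) (disp : measure_display)
    (T : measurableType disp) (P : probability T R) (I : choiceType)
    (X : I -> {RV P >-> R}) :=
  forall (s : seq I) (B : I -> set R), uniq s ->
    (forall i, measurable (B i)) ->
    P (\bigcap_(i in [set` s]) (X i @^-1` B i)) =
    (\prod_(i <- s) P (X i @^-1` B i))%E.

Definition iid_standard_gaussian (R : realType) (disp : measure_display)
    (T : measurableType disp) (P : probability T R) (I : choiceType)
    (X : I -> {RV P >-> R}) :=
  mutually_independent X /\
  forall i (A : set R), measurable A -> distribution P (X i) A = normal_prob 0 1 A.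

Section model.
Variables (R : realType) (d k : nat).

(* The product sigma-algebra on the sample space. *)
Definition sample_sigma_algebra : set (set (sample R d k)) :=
  <<s \bigcup_(i in [set: obs_index d k])
        preimage_set_system setT (fun x : sample R d k => x i) measurable >>.

Definition selector : set (sample R d k -> {ffun kset d k -> bool}) :=
  [set est : sample R d k -> {ffun kset d k -> bool} |
    forall u : kset d k, sample_sigma_algebra [set x | est x u]].

Variables (disp : measure_display) (T : measurableType disp).
Variables (P : probability T R) (xi : obs_index d k -> {RV P >-> R}).

Definition observation (eps : R) (theta : parameter R d k)
    (eta : {ffun kset d k -> bool}) (w : T) : sample R d k :=
  fun i => (eta (tag i))%:R * theta (tag i) (tagged i) + eps * xi i w.

Definition hamming_risk (eps : R) (theta : parameter R d k)
    (eta : {ffun kset d k -> bool})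
    (est : sample R d k -> {ffun kset d k -> bool}) : \bar R :=
  'E_P[fun w => (hamming (est (observation eps theta eta w)) eta)%:R]%E.

Definition minimax_risk (beta sigma delta eps r : R) : \bar R :=
  ereal_inf [set
    ereal_sup [set
      ereal_sup [set
        (('C(d, k)%:R `^ (beta - 1))%:E * hamming_risk eps theta eta est)%E
      | theta in @ellipsoids R sigma d k r]
    | eta in @sparsity_class d k R beta delta]
  | est in selector].

End model.

(* Main.v *)
(* The lower bound is Fano's inequality for a blockwise prior. Split
   [M = floor(N^(1 - beta))] blocks of about [N^beta] k-sets off the
   [N = 'C(d, k)] k-sets and make one uniformly chosen k-set per block active, its
   coefficients being those of a nearly extremal [theta] of the ellipsoid with
   independent random signs. At one coordinate, the relative entropy between the
   symmetric mixture of [N(a, 1)] and [N(-a, 1)] and the noise is at most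
   [a ^+ 4 / 4], so the entropy of a whole k-set is half the squared detection
   function, hence at most [c ln N] with [c < beta]. A block has entropy about
   [beta ln N], so a selector misses a fraction of at least about [1 - c / beta] of
   the blocks.

   The entropy bound is exact, without remainder, because
   [ln (cosh y) <= (y ^+ 2 + y tanh y) / 4] and the right-hand side has expectation
   [s / 2 + s ^+ 2 / 4] under [N(s, s)]. *)

From HB Require Import structures.
Require Import Defs.
From mathcomp Require Import all_boot all_order all_algebra.
From mathcomp Require Import all_classical all_reals all_analysis.
From mathcomp Require Import ring lra measurable_realfun.
Import Order.TTheory GRing.Theory Num.Theory.
Import numFieldNormedType.Exports.
Set Implicit Arguments.
Unset Strict Implicit.
Unset Printing Implicit Defensive.
Local Open Scope classical_set_scope.
Local Open Scope ring_scope.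

(** The signs are what produces the fourth power: a known shift by [a] has entropy [a ^+ 2 / 2]
    against the noise, and averaging over the two signs cancels this order, leaving the quantity
    that the detection function measures. The price is a mixture, whose entropy involves
    [ln (cosh y)]; hence the hyperbolic and Gaussian estimates. No mutual information is formed.
    Configurations form a finite set, so a configuration with at least the average risk exists and
    no measure on parameters is needed. The data have infinitely many coordinates. The extremal
    [theta] is therefore truncated to finitely many frequencies, which makes every likelihood ratio
    a finite product, and the truncation must respect both ellipsoid constraints exactly. *)

Section hyperbolic.
Variable R : realType.
Implicit Types x y h : R.

(** * Inequalities between hyperbolic functions *)

Definition cosh x : R := (expR x + expR (- x)) / 2.
Definition sinh x : R := (expR x - expR (- x)) / 2.

Lemma coshN x : cosh (- x) = cosh x.
Proof. by rewrite /cosh opprK addrC. Qed.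

Lemma sinhN x : sinh (- x) = - sinh x.
Proof. by rewrite /sinh opprK -mulNr opprB. Qed.

Lemma cosh0 : cosh 0 = 1.
Proof. by rewrite /cosh oppr0 expR0; lra. Qed.

Lemma sinh0 : sinh 0 = 0.
Proof. by rewrite /sinh oppr0 subrr mul0r. Qed.

Lemma cosh_gt0 x : 0 < cosh x.
Proof. by rewrite divr_gt0 ?addr_gt0 ?expR_gt0. Qed.

Lemma coshD x y : cosh (x + y) = cosh x * cosh y + sinh x * sinh y.
Proof. by rewrite /cosh /sinh opprD !expRD; field. Qed.

Lemma sinhD x y : sinh (x + y) = sinh x * cosh y + cosh x * sinh y.
Proof. by rewrite /cosh /sinh opprD !expRD; field. Qed.

Lemma cosh2_sinh2 x : cosh x ^+ 2 - sinh x ^+ 2 = 1.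
Proof.
have := coshD x (- x); rewrite subrr cosh0 coshN sinhN => ->.
by rewrite mulrN !expr2.
Qed.

Global Instance is_derive_cosh x : is_derive x 1 cosh (sinh x).
Proof.
have -> : cosh = 2^-1 \*: (fun x : R => expR x + (expR x)^-1).
  by apply/funext => z; rewrite /cosh /= expRN /GRing.scale/= mulrC.
apply: is_derive_eq; first by apply: is_deriveZ; apply: is_deriveD;
  apply: is_deriveV; rewrite gt_eqF ?expR_gt0.
rewrite /sinh expRN /GRing.scale/=; field.
by rewrite gt_eqF ?expR_gt0.
Qed.

Global Instance is_derive_sinh x : is_derive x 1 sinh (cosh x).
Proof.
have -> : sinh = 2^-1 \*: (fun x : R => expR x - (expR x)^-1).
  by apply/funext => z; rewrite /sinh /= expRN /GRing.scale/= mulrC.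
apply: is_derive_eq; first by apply: is_deriveZ; apply: is_deriveB;
  apply: is_deriveV; rewrite gt_eqF ?expR_gt0.
rewrite /cosh expRN /GRing.scale/=; field.
by rewrite gt_eqF ?expR_gt0.
Qed.

Lemma ge0_derive_ge_at0 (f g : R -> R) :
  (forall x, is_derive x 1 f (g x)) -> (forall x, 0 <= x -> 0 <= g x) ->
  forall x, 0 <= x -> f 0 <= f x.
Proof.
move=> fg g0 x x0; apply: (@ger0_derive1_ndecry _ f 0) => // z.
- rewrite in_itv/= andbT => /ltW z0.
  by rewrite derive1E derive_val; exact: g0.
- apply: continuous_subspaceT => {}z.
  by apply/differentiable_continuous/derivable1_diffP; exact: ex_derive.
Qed.

Lemma sinh_ge0 x : 0 <= x -> 0 <= sinh x.
Proof. by move=> x0; rewrite divr_ge0// subr_ge0 ler_expR; lra. Qed.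

Lemma cosh_ge1 x : 1 <= cosh x.
Proof.
wlog x0 : x / 0 <= x => [H|].
  case: (leP 0 x) => [/H //|/ltW x0].
  by rewrite -coshN; apply: H; rewrite oppr_ge0.
rewrite -cosh0; apply: (ge0_derive_ge_at0 (g := sinh)) => // z; exact: sinh_ge0.
Qed.

Lemma xsinh_ge0 x : 0 <= x * sinh x.
Proof.
case: (leP 0 x) => [x0|/ltW x0]; first by rewrite mulr_ge0// sinh_ge0.
by rewrite -mulrNN -sinhN mulr_ge0 ?sinh_ge0 ?oppr_ge0.
Qed.

(** This starts a chain of three inequalities: the derivative of the difference of the two sides of
    each later one is the difference of the previous one, and all vanish at 0. *)
Lemma sinh_le_xcosh x : 0 <= x -> sinh x <= x * cosh x.
Proof.
move=> x0; rewrite -subr_ge0.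
have := @ge0_derive_ge_at0 (fun z : R => z * cosh z - sinh z) (fun z => z * sinh z) _ _ x x0.
rewrite mul0r sinh0 subr0; apply=> z; last by move=> z0; rewrite mulr_ge0// sinh_ge0.
by apply: is_derive_eq; rewrite /GRing.scale/=; ring.
Qed.

Lemma cosh_quadratic_le x : 0 <= x -> 2 * cosh x <= 2 + x * sinh x.
Proof.
move=> x0; rewrite -subr_ge0.
have := @ge0_derive_ge_at0 (fun z : R => 2 + z * sinh z - 2 * cosh z)
  (fun z => z * cosh z - sinh z) _ _ x x0.
rewrite mul0r cosh0 addr0 mulr1 subrr; apply=> z; last first.
  by move=> z0; rewrite subr_ge0 sinh_le_xcosh.
by apply: is_derive_eq; rewrite /GRing.scale/=; ring.
Qed.

(** Hyperbolic form of the Cusa-Huygens inequality, with equality up to order [x ^+ 3]. Taken at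
    [2 * z], it gives the sign of the derivative in [ln_cosh_le]. *)
Lemma sinh_le_pade x : 0 <= x -> 3 * sinh x <= x * (cosh x + 2).
Proof.
move=> x0; rewrite -subr_ge0.
have := @ge0_derive_ge_at0 (fun z : R => z * (cosh z + 2) - 3 * sinh z)
  (fun z => 2 + z * sinh z - 2 * cosh z) _ _ x x0.
rewrite mul0r sinh0 mulr0 subr0; apply=> z; last first.
  by move=> z0; rewrite subr_ge0 cosh_quadratic_le.
by apply: is_derive_eq; rewrite /GRing.scale/=; ring.
Qed.

(* The two terms are chosen so that the bound is sharp up to order [x ^+ 4] and
   has expectation [s / 2 + s ^+ 2 / 4] under [N(s, s)]. *)
Lemma ln_cosh_le x : ln (cosh x) <= (x ^+ 2 + x * sinh x / cosh x) / 4.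
Proof.
wlog x0 : x / 0 <= x => [H|].
  case: (leP 0 x) => [/H //|/ltW x0].
  by have := H (- x); rewrite coshN sinhN sqrrN mulrNN oppr_ge0; apply.
rewrite ler_pdivlMr// -subr_ge0.
(* The derivative is 2z - 3 tanh z + z / cosh^2 z. Over the common denominator cosh^2 z, the
   duplication formulas turn it into the expression bounded by [sinh_le_pade] at [2 * z]. *)
have := @ge0_derive_ge_at0 (fun z : R => z ^+ 2 + z * sinh z / cosh z - ln (cosh z) * 4)
  (fun z => ((2 * z) * (cosh (2 * z) + 2) - 3 * sinh (2 * z)) / 2 / cosh z ^+ 2) _ _ x x0.
rewrite cosh0 sinh0 ln1 mulr0 expr0n/= !mul0r !addr0 subrr; apply=> z; last first.
  by move=> z0; rewrite divr_ge0 ?sqr_ge0// divr_ge0// subr_ge0 sinh_le_pade// mulr_ge0.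
have c0 := cosh_gt0 z; have cN0 : cosh z != 0 by rewrite gt_eqF.
have ? : is_derive z 1 (fun z : R => (cosh z)^-1) (- cosh z ^- 2 *: sinh z) by exact: is_deriveV.
have ? : is_derive z 1 (fun z : R => ln (cosh z)) ((cosh z)^-1 * sinh z).
  by apply: (@is_derive1_comp _ (@ln R) cosh) => //; exact: is_derive1_ln.
apply: is_derive_eq; rewrite /GRing.scale/= mulr_natl mulr2n coshD sinhD.
have E := cosh2_sinh2 z.
have E2 : sinh z ^+ 2 = cosh z ^+ 2 - 1 by rewrite -E; ring.
have E3 : sinh z * sinh z = cosh z ^+ 2 - 1 by rewrite -expr2.
field: E2 => //.
Qed.

End hyperbolic.

(** * Integration against a measure given by a density *)

Section density.
Local Open Scope ereal_scope.
Context dT (T : measurableType dT) (R : realType).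
Variables (m nu : {measure set T -> \bar R}) (h : T -> R).
Hypotheses (mh : measurable_fun setT h) (h0 : forall x, (0 <= h x)%R).
Hypothesis nuE : forall A, measurable A -> nu A = \int[m]_(x in A) (h x)%:E.

Import HBNNSimple.

Let mh' : measurable_fun setT (EFin \o h).
Proof. exact/measurable_EFinP. Qed.

Let integral_density_nnsfun (f : {nnsfun T >-> R}) :
  \int[nu]_x (f x)%:E = \int[m]_x ((f x)%:E * (h x)%:E).
Proof.
have mind r : measurable_fun setT (fun x => (r * \1_(f @^-1` [set r]) x)%:E : \bar R).
  by apply/measurable_EFinP; exact: measurableT_comp.
under [LHS]eq_integral do rewrite fimfunE -fsumEFin//.
rewrite [LHS]ge0_integral_fsum//; last first.
  by move=> n x _; rewrite EFinM nnfun_muleindic_ge0.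
under [RHS]eq_integral.
  move=> x xD; rewrite muleC fimfunE -fsumEFin// ge0_mule_fsumr; last first.
    by move=> r; rewrite EFinM nnfun_muleindic_ge0.
  over.
rewrite [RHS]ge0_integral_fsum//; last 2 first.
  - by move=> r; apply: emeasurable_funM.
  - move=> n x _; apply: mule_ge0; first by rewrite lee_fin.
    by rewrite EFinM nnfun_muleindic_ge0.
apply: eq_fsbigr => r _; rewrite integralZl_indic_nnsfun//.
(* The simple function is nonnegative, so its negative levels have empty preimage; only [0 <= r] has
   real content. *)
have [r0|r0] := leP 0%R r; last first.
  rewrite preimage_nnfun0// integral_indic// set0I measure0 mule0.
  by rewrite integral0_eq// => x _; rewrite indic0 mulr0 mule0.
transitivity (r%:E * \int[m]_x ((h x)%:E * (\1_(f @^-1` [set r]) x)%:E)).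
  congr *%E; rewrite integral_indic// setIT nuE// integral_mkcond.
  apply: eq_integral => x _; rewrite patchE indicE.
  by case: ifPn; rewrite ?mule1 ?mule0.
rewrite -ge0_integralZl//.
- by apply: eq_integral => x _; rewrite -!EFinM mulrCA.
- apply: emeasurable_funM => //; exact/measurable_EFinP/measurable_indic.
- by move=> x _; rewrite mule_ge0// lee_fin.
Qed.

Lemma ge0_integral_density (f : T -> \bar R) :
  measurable_fun setT f -> (forall x, 0 <= f x) ->
  \int[nu]_x f x = \int[m]_x (f x * (h x)%:E).
Proof.
move=> mf f0.
pose f_ := nnsfun_approx measurableT mf.
transitivity (limn (fun n => \int[nu]_x (f_ n x)%:E)).
  rewrite -monotone_convergence//=.
  - apply: eq_integral => ? /[!inE] xD; apply/esym/cvg_lim => //=.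
    exact: cvg_nnsfun_approx.
  - by move=> n; exact/measurable_EFinP/measurable_funTS.
  - by move=> n ? _; rewrite lee_fin.
  - by move=> ? _ ? ? mn; rewrite lee_fin; exact/lefP/nd_nnsfun_approx.
rewrite [RHS](_ : _ = limn (fun n => \int[m]_x ((f_ n x)%:E * (h x)%:E))).
  by apply: congr_lim; apply/funext => n /=; exact: integral_density_nnsfun.
rewrite -monotone_convergence//=.
- apply: eq_integral => x _; apply/esym/cvg_lim => //.
  by apply: cvgeZr => //; exact: cvg_nnsfun_approx.
- move=> n; apply: emeasurable_funM => //.
  exact/measurable_EFinP/measurable_funTS.
- by move=> n x _; rewrite mule_ge0 ?lee_fin.
- move=> x _ a b ab; rewrite lee_wpmul2r ?lee_fin//.
  exact/lefP/nd_nnsfun_approx.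
Qed.

End density.

(** * Translation and exponential moments of the standard Gaussian *)

Section standard_gaussian.
Context {R : realType}.
Implicit Types (a b s x : R) (f : R -> \bar R).
Local Notation gauss := (normal_prob (0 : R) 1 : probability _ _).
Local Notation mu := (@lebesgue_measure R).

Lemma lebesgue_measure_shift a (A : set R) : measurable A ->
  pushforward mu ((fun x => x + a) : measurableTypeR R -> measurableTypeR R) A = mu A.
Proof.
move=> mA; apply/esym.
apply: (@lebesgue_measure_unique R
  (pushforward mu ((fun x => x + a) : measurableTypeR R -> measurableTypeR R))) => //=.
  exact: measurable_funD.
move=> ms _ [[u v] _ <-]; rewrite /pushforward /=.
have -> : (fun x => x + a) @^-1` `]u, v]%classic = `](u - a), (v - a)]%classic.
  by apply/seteqP; split=> x /=; rewrite !in_itv/= ltrBlDr lerBrDr.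
rewrite !lebesgue_measure_itv/= !lte_fin ltrD2r; case: ifP => // _.
by rewrite -!EFinB; congr EFin; ring.
Qed.

Lemma ge0_integral_gauss f : measurable_fun setT f -> (forall x, 0 <= f x)%E ->
  (\int[gauss]_x f x = \int[mu]_x (f x * (normal_pdf 0 1 x)%:E))%E.
Proof.
move=> mf f0; apply: ge0_integral_density => //.
- exact: measurable_normal_pdf.
- by move=> x; exact: normal_pdf_ge0.
Qed.

Lemma normal_pdf_shift a x :
  normal_pdf 0 1 (x - a) = expR (a * x - a ^+ 2 / 2) * normal_pdf (0 : R) 1 x.
Proof.
rewrite !normal_pdfE ?oner_neq0// /normal_fun mulrCA -expRD; congr (_ * expR _).
by rewrite expr1n; field.
Qed.

(** The Cameron-Martin formula in dimension one: translation invariance of Lebesgue measure, with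
    [normal_pdf_shift] as likelihood ratio. *)
Lemma ge0_integral_gauss_shift a f :
  measurable_fun setT f -> (forall x, 0 <= f x)%E ->
  (\int[gauss]_x f (x + a)%R =
   \int[gauss]_x (f x * (expR (a * x - a ^+ 2 / 2))%:E))%E.
Proof.
move=> mf f0.
have ms : measurable_fun setT (fun x => x + a) by exact: measurable_funD.
have mpdf : measurable_fun setT (EFin \o normal_pdf (0 : R) 1).
  by apply/measurable_EFinP; exact: measurable_normal_pdf.
have me : measurable_fun setT (fun x => (expR (a * x - a ^+ 2 / 2))%:E).
  apply/measurable_EFinP; apply: measurableT_comp => //.
  by apply: measurable_funB => //; exact: measurable_funM.
rewrite !ge0_integral_gauss//; first last.
- exact: measurableT_comp.
- by move=> x; rewrite mule_ge0// lee_fin expR_ge0.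
- exact: emeasurable_funM.
pose g x := (f x * (normal_pdf 0 1 (x - a))%:E)%E.
transitivity (\int[mu]_x g (x + a)%R)%E.
  by apply: eq_integral => x _; rewrite /g addrK.
have mg : measurable_fun setT g.
  apply: emeasurable_funM => //; apply: (measurableT_comp mpdf).
  exact: measurable_funB.
have g0 x : (0 <= g x)%E by rewrite mule_ge0// lee_fin normal_pdf_ge0.
transitivity (\int[mu]_x g x)%E; last first.
  apply: eq_integral => x _.
  by rewrite /g normal_pdf_shift EFinM muleA.
rewrite -(@ge0_integral_pushforward _ _ _ _ _
  ((fun x => x + a) : measurableTypeR R -> measurableTypeR R) ms mu setT g)//.
apply: eq_measure_integral => A mA _; exact: lebesgue_measure_shift.
Qed.

Lemma mgf_gauss a : (\int[gauss]_x (expR (a * x))%:E = (expR (a ^+ 2 / 2))%:E)%E.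
Proof.
have me : measurable_fun setT (fun x => (expR (a * x - a ^+ 2 / 2))%:E).
  apply/measurable_EFinP; apply: measurableT_comp => //.
  by apply: measurable_funB => //; exact: measurable_funM.
transitivity ((expR (a ^+ 2 / 2))%:E * \int[gauss]_x (expR (a * x - a ^+ 2 / 2))%:E)%E.
  rewrite -ge0_integralZl//.
  by apply: eq_integral => x _; rewrite -EFinM -expRD addrC subrK.
have -> : (\int[gauss]_x (expR (a * x - a ^+ 2 / 2))%:E = 1)%E.
  (* The shift formula for the constant 1 says that the likelihood ratio has mass 1. *)
  transitivity (\int[gauss]_x (cst 1%E (x + a)%R))%E.
    rewrite ge0_integral_gauss_shift//; apply: eq_integral => x _.
    by rewrite mul1e.
  by rewrite integral_cst// mul1e; exact: probability_setT.
by rewrite mule1.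
Qed.

Lemma integral_gauss_cosh a :
  (\int[gauss]_x (cosh (a * x))%:E = (expR (a ^+ 2 / 2))%:E)%E.
Proof.
have me b : measurable_fun setT (fun x => (expR (b * x))%:E).
  by apply/measurable_EFinP; apply: measurableT_comp => //; exact: measurable_funM.
have e0 b x : (0 <= (expR (b * x))%:E)%E by rewrite lee_fin expR_ge0.
transitivity ((2^-1)%:E * \int[gauss]_x ((expR (a * x))%:E + (expR (- a * x))%:E))%E.
  rewrite -ge0_integralZl//.
  - by apply: eq_integral => x _; rewrite -EFinD -EFinM /cosh mulrC mulNr.
  - exact: (emeasurable_funD (me a) (me (- a))).
  - by move=> x _; apply: adde_ge0.
rewrite ge0_integralD //; try exact: me.
by rewrite !mgf_gauss sqrrN -EFinD -EFinM; congr EFin; field.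
Qed.

End standard_gaussian.

(** * Second differences replacing differentiation under the Gaussian integral *)

Section expansions.
Variable R : realType.
Implicit Types x y h s : R.

Lemma sinh_ge x : 0 <= x -> x <= sinh x.
Proof.
move=> x0; rewrite -subr_ge0.
have := @ge0_derive_ge_at0 _ (fun z : R => sinh z - z) (fun z => cosh z - 1) _ _ x x0.
rewrite sinh0 subr0; apply=> z _; last by rewrite subr_ge0 cosh_ge1.
Qed.

Lemma cosh_ge_quadratic x : 1 + x ^+ 2 / 2 <= cosh x.
Proof.
wlog x0 : x / 0 <= x => [H|].
  case: (leP 0 x) => [/H //|/ltW x0].
  by rewrite -coshN -sqrrN; apply: H; rewrite oppr_ge0.
rewrite -subr_ge0.
have := @ge0_derive_ge_at0 _ (fun z : R => cosh z - (1 + z ^+ 2 * 2^-1))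
  (fun z => sinh z - z) _ _ x x0.
rewrite cosh0 expr0n/= mul0r addr0 subrr; apply=> z.
  by apply: is_derive_eq; rewrite /GRing.scale/=; field.
by move=> z0; rewrite subr_ge0 sinh_ge.
Qed.

Lemma expRN_le_quadratic x : 0 <= x -> expR (- x) <= 1 - x + x ^+ 2 / 2.
Proof.
move=> x0; rewrite -subr_ge0.
have := @ge0_derive_ge_at0 _ (fun z : R => 1 - z + z ^+ 2 * 2^-1 - (cosh z - sinh z))
  (fun z => (cosh z - sinh z) - 1 + z) _ _ x x0.
have e (z : R) : expR (- z) = cosh z - sinh z by rewrite /cosh /sinh; field.
rewrite e cosh0 sinh0 expr0n/= mul0r !subr0 addr0 subrr; apply=> z.
  by apply: is_derive_eq; rewrite /GRing.scale/=; field.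
by move=> z0; rewrite -e; have := expR_ge1Dx (- z); lra.
Qed.

Lemma expRN_ge_cubic x : 0 <= x -> 1 - x + x ^+ 2 / 2 - x ^+ 3 / 6 <= expR (- x).
Proof.
move=> x0; rewrite -subr_ge0.
have := @ge0_derive_ge_at0 _
  (fun z : R => (cosh z - sinh z) - (1 - z + z ^+ 2 * 2^-1 - z ^+ 3 * 6^-1))
  (fun z => 1 - z + z ^+ 2 / 2 - (cosh z - sinh z)) _ _ x x0.
have e (z : R) : expR (- z) = cosh z - sinh z by rewrite /cosh /sinh; field.
rewrite e cosh0 sinh0 !expr0n/= !mul0r !subr0 addr0 subrr; apply=> z.
  by apply: is_derive_eq; rewrite /GRing.scale/=; field.
by move=> z0; rewrite -e subr_ge0 expRN_le_quadratic.
Qed.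

(** The product of the right-hand side and the cubic minorant of [expR (- x)] is at least 1. The
    cubic coefficient 1 in place of 1/6 leaves the room for this up to [x = 1 / 2]. *)
Lemma expR_le_cubic x : 0 <= x <= 1 / 2 -> expR x <= 1 + x + x ^+ 2 / 2 + x ^+ 3.
Proof.
move=> /andP[x0 x1]; set p := 1 + _ + _ + _.
have p0 : 0 <= p by rewrite /p !addr_ge0// ?exprn_ge0// divr_ge0// exprn_ge0.
rewrite -[leRHS]mul1r -[in leRHS](@mulfV _ (expR (- x))) ?gt_eqF ?expR_gt0//.
rewrite -expRN opprK mulrAC -[leLHS]mul1r ler_pM2r ?expR_gt0//.
apply: le_trans (ler_wpM2r p0 (expRN_ge_cubic x0)); rewrite /p.
have q2 : 0 <= x ^+ 2 by rewrite sqr_ge0.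
have q : 0 <= x ^+ 3 * (5 / 6 - 11 / 12 * x + x ^+ 2 * (5 / 12 - x / 6)).
  rewrite mulr_ge0 ?exprn_ge0// addr_ge0//; first lra.
  by rewrite mulr_ge0//; lra.
rewrite -subr_ge0; apply: le_trans q _; rewrite le_eqVlt; apply/orP; left.
by apply/eqP; field.
Qed.

(* With [y = a x] and [x] standard Gaussian, every term is a hyperbolic cosine
   except the one multiplied by [h ^+ 2]. *)
Lemma cosh_second_difference h y : 0 < h ->
  h ^+ 2 * (y ^+ 2 * cosh y + y * sinh y) + (2 + h) * cosh y <=
  (1 + h) * cosh ((1 + h) * y) + cosh ((1 - h) * y).
Proof.
move=> h0.
have c0 := cosh_gt0 y.
have q := cosh_ge_quadratic (h * y).
have t : h * (y * sinh y) <= sinh y * sinh (h * y).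
  wlog y0 : y {c0 q} / 0 <= y => [Hy|].
    case: (leP 0 y) => [/Hy //|/ltW y0].
    by have := Hy (- y); rewrite mulrN !sinhN !mulrNN oppr_ge0; apply.
  rewrite (_ : h * _ = sinh y * (h * y)); last ring.
  by rewrite ler_wpM2l ?sinh_ge0// sinh_ge// mulr_ge0// ltW.
(* After expansion the right-hand side is (2 + h) cosh y cosh(hy) + h sinh y sinh(hy). The weight
   [1 + h] is there to keep the second product, which yields the term [y * sinh y]. *)
have -> : (1 + h) * y = y + h * y by ring.
have -> : (1 - h) * y = y + - (h * y) by ring.
rewrite !coshD coshN sinhN.
have A : cosh y * (1 + (h * y) ^+ 2 / 2) <= cosh y * cosh (h * y) by rewrite ler_wpM2l// ltW.
have B : cosh y <= cosh y * cosh (h * y) by rewrite ler_peMr ?cosh_ge1// ltW.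
have A' := A; rewrite mulrDr mulr1 in A'.
have C1 : h * cosh y <= h * (cosh y * cosh (h * y)) by rewrite ler_wpM2l// ltW.
have D : h * (h * (y * sinh y)) <= h * (sinh y * sinh (h * y)) by rewrite ler_wpM2l// ltW.
have E : cosh y * ((h * y) ^+ 2 / 2) * 2 = h ^+ 2 * (y ^+ 2 * cosh y) by field.
have E' : h ^+ 2 * (y * sinh y) = h * (h * (y * sinh y)) by ring.
rewrite !mulrDr !mulrDl E' -E !mul1r.
lra.
Qed.

(** The limit h -> 0 of the second-difference inequality: on the right, the terms of order 0 and 1
    in [h] are 2 + h, and the coefficient of h^2 is 2s + s^2. *)
Lemma second_difference_limit s t : 0 <= s ->
  (forall h, 0 < h -> t * h ^+ 2 + (2 + h) <=
     (1 + h) * expR (h * s + h ^+ 2 * s / 2) + expR (- (h * s - h ^+ 2 * s / 2))) ->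
  t <= 2 * s + s ^+ 2.
Proof.
move=> s0 H; apply/ler_addgt0Pr => e e0.
(* [C] bounds the remainder after division by [h ^+ 2] and then by [h]. In [h], the first bound
   keeps the argument of [expR_le_cubic] below 1/2 and the second makes the remainder at most
   [e]. *)
pose C := s / 2 + s ^+ 2 + 8 * s ^+ 3.
have C0 : 0 <= C by rewrite /C !addr_ge0 ?mulr_ge0 ?exprn_ge0.
pose h := Num.min (1 / (3 * s + 2)) (e / (C + 1)).
have h0 : 0 < h by rewrite lt_min !divr_gt0//; lra.
have h1 : h * (3 * s + 2) <= 1.
  by rewrite -ler_pdivlMr; [rewrite /h ge_min lexx|lra].
have h2 : h * (C + 1) <= e.
  by rewrite -ler_pdivlMr; [rewrite /h ge_min lexx orbT|lra].
have hs0 : 0 <= h * s by rewrite mulr_ge0// ltW.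
have h3 : h <= 1 / 2 by nra.
have hhs0 : 0 <= h * (h * s) by rewrite mulr_ge0// ltW.
have hhs1 : h * (h * s) <= 1 / 2 * (h * s) by rewrite ler_wpM2r.
have E1 : h ^+ 2 * s = h * (h * s) by ring.
have x1 : expR (h * s + h ^+ 2 * s / 2) <=
    1 + (h * s + h ^+ 2 * s / 2) + (h * s + h ^+ 2 * s / 2) ^+ 2 / 2 +
    (h * s + h ^+ 2 * s / 2) ^+ 3.
  by apply: expR_le_cubic; rewrite E1; apply/andP; split; lra.
have x2 : expR (- (h * s - h ^+ 2 * s / 2)) <=
    1 - (h * s - h ^+ 2 * s / 2) + (h * s - h ^+ 2 * s / 2) ^+ 2 / 2.
  by apply: expRN_le_quadratic; rewrite E1; lra.
have h1p : 0 <= 1 + h by lra.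
have {}H := le_trans (H h h0) (lerD (ler_wpM2l h1p x1) x2).
have K : h ^+ 2 * t <= h ^+ 2 * (2 * s + s ^+ 2 +
    h * (s / 2 + s ^+ 2 / 2 * (1 + 3 / 2 * h + h ^+ 2 / 4) + (1 + h) * (1 + h / 2) ^+ 3 * s ^+ 3)).
  rewrite -subr_ge0; rewrite -subr_ge0 in H; apply: le_trans H _.
  by rewrite le_eqVlt; apply/orP; left; apply/eqP; field.
rewrite ler_pM2l ?exprn_gt0// in K; apply: le_trans K _; rewrite lerD2l.
apply: le_trans h2; rewrite ler_wpM2l ?(ltW h0)//.
apply: (@le_trans _ _ C); last by lra.
have hh : h ^+ 2 <= 1 / 4 by rewrite expr2; nra.
rewrite /C; apply: lerD; first apply: lerD => //.
  rewrite -[leRHS](@divfK _ 2)// ler_wpM2l ?divr_ge0 ?sqr_ge0//; lra.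
rewrite ler_wpM2r ?exprn_ge0//.
have a1 : (1 + h / 2) ^+ 3 <= 2 ^+ 3.
  by rewrite lerXn2r ?nnegrE//; lra.
have : (1 + h) * (1 + h / 2) ^+ 3 <= 1 * (1 + h / 2) ^+ 3 + h * 2 ^+ 3.
  by rewrite mulrDl lerD2l ler_wpM2l// ltW.
have -> : 1 * (1 + h / 2) ^+ 3 = 1 + 3 / 2 * h + 3 / 4 * h ^+ 2 + h * h ^+ 2 / 8 by field.
have : h * h ^+ 2 <= h * (1 / 4) by rewrite ler_wpM2l// ltW.
lra.
Qed.

End expansions.

Lemma ge0_integral_lincomb dT (T : measurableType dT) (R : realType)
    (m : {measure set T -> \bar R}) (f g : T -> R) (a b : R) :
  measurable_fun setT f -> measurable_fun setT g ->
  (forall x, 0 <= f x) -> (forall x, 0 <= g x) -> 0 <= a -> 0 <= b ->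
  (\int[m]_x (a * f x + b * g x)%:E =
   a%:E * \int[m]_x (f x)%:E + b%:E * \int[m]_x (g x)%:E)%E.
Proof.
move=> mf mg f0 g0 a0 b0.
rewrite -ge0_integralZl//; [|exact/measurable_EFinP|by move=> *; rewrite lee_fin].
rewrite -ge0_integralZl//; [|exact/measurable_EFinP|by move=> *; rewrite lee_fin].
have mE (c : R) (k : T -> R) : measurable_fun setT k ->
    measurable_fun setT (fun x => c%:E * (k x)%:E)%E.
  by move=> mk; apply/measurable_EFinP; exact: measurable_funM.
rewrite -ge0_integralD//; try exact: mE.
- by move=> x _; rewrite lee_fin mulr_ge0.
- by move=> x _; rewrite lee_fin mulr_ge0.
Qed.

Section gaussian_moments.
Context {R : realType}.
Local Notation gauss := (normal_prob (0 : R) 1 : probability _ _).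

Lemma measurable_cosh : measurable_fun setT (@cosh R).
Proof.
apply: measurable_funM => //; apply: measurable_funD => //.
by apply: measurableT_comp => //.
Qed.

Lemma measurable_sinh : measurable_fun setT (@sinh R).
Proof.
apply: measurable_funM => //; apply: measurable_funB => //.
by apply: measurableT_comp => //.
Qed.

(** The operator d/dl (l d/dl) applied to cosh(l y), at l = 1; divided by 4 cosh y, it is the bound
    of [ln_cosh_le]. *)
Definition cosh_moment (y : R) := y ^+ 2 * cosh y + y * sinh y.

Lemma cosh_moment_ge0 y : 0 <= cosh_moment y.
Proof. by rewrite addr_ge0 ?xsinh_ge0// mulr_ge0 ?sqr_ge0// ltW// cosh_gt0. Qed.

Lemma measurable_cosh_moment : measurable_fun setT cosh_moment.
Proof.
apply: measurable_funD; apply: measurable_funM => //.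
- exact: measurable_cosh.
- exact: measurable_sinh.
Qed.

(** The right-hand side is the same operator d/dl (l d/dl), at l = 1, applied to exp(l^2 a^2 / 2),
    the mean of cosh(l a x). Integrating [cosh_second_difference] and letting [h] tend to 0 gives
    the upper bound, which suffices. *)
Lemma integral_gauss_cosh_moment (a : R) :
  (\int[gauss]_x (cosh_moment (a * x))%:E <=
   (expR (a ^+ 2 / 2) * (2 * a ^+ 2 + (a ^+ 2) ^+ 2))%:E)%E.
Proof.
have ma (b : R) : measurable_fun setT (fun x => b * x) by exact: measurable_funM.
have mT : measurable_fun setT (fun x => cosh_moment (a * x)).
  exact: (measurableT_comp measurable_cosh_moment).
have mC (b : R) : measurable_fun setT (fun x => cosh (b * x)).
  exact: (measurableT_comp measurable_cosh).
have T0 x : 0 <= cosh_moment (a * x) by exact: cosh_moment_ge0.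
have C0 (b x : R) : 0 <= cosh (b * x) by rewrite ltW// cosh_gt0.
have mlin (b c e : R) (f : R -> R) : measurable_fun setT f ->
    measurable_fun setT (fun x => b * f x + c * cosh (e * x)).
  move=> mf; apply: measurable_funD; apply: measurable_funM => //; exact: mC.
set T := (\int[gauss]_x _)%E.
have Tge0 : (0 <= T)%E by apply: integral_ge0 => x _; rewrite lee_fin.
have key (h : R) : 0 < h -> ((h ^+ 2)%:E * T + ((2 + h) * expR (a ^+ 2 / 2))%:E <=
    ((1 + h) * expR (((1 + h) * a) ^+ 2 / 2) + expR (((1 - h) * a) ^+ 2 / 2))%:E)%E.
  move=> h0; rewrite (EFinD (_ * _)) !EFinM -!integral_gauss_cosh -[X in (_ <= _ + X)%E]mul1e.
  have h1 : 0 <= 1 + h by lra.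
  have h2 : 0 <= 2 + h by lra.
  rewrite -!ge0_integral_lincomb ?sqr_ge0//; try exact: mC.
  apply: ge0_le_integral => //.
  - by move=> x _; rewrite lee_fin addr_ge0// mulr_ge0 ?sqr_ge0.
  - by apply/measurable_EFinP; exact: mlin.
  - by apply/measurable_EFinP; exact: mlin.
  - move=> x _; rewrite lee_fin mul1r -!(mulrA _ a x).
    exact: cosh_second_difference.
have Tfin : T \is a fin_num.
  (* The single value [h = 1] already shows that the moment is finite, so the argument continues
     with real numbers. *)
  have H := key 1 ltr01; rewrite expr1n mul1e in H.
  rewrite ge0_fin_numE//; apply: le_lt_trans (ltry _); apply: le_trans H.
  by rewrite leeDl// lee_fin mulr_ge0 ?expR_ge0//; lra.
rewrite -(fineK Tfin) lee_fin mulrC -ler_pdivrMr ?expR_gt0//.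
apply: second_difference_limit; first exact: sqr_ge0.
move=> h h0; have := key h h0; rewrite -(fineK Tfin) -EFinM -EFinD lee_fin => K.
rewrite -(ler_pM2l (expR_gt0 (a ^+ 2 / 2))).
rewrite [X in X <= _](_ : _ = h ^+ 2 * fine T + (2 + h) * expR (a ^+ 2 / 2)).
  apply: (le_trans K); rewrite mulrDr mulrCA -!expRD le_eqVlt; apply/orP; left.
  by apply/eqP; congr (_ * expR _ + expR _); field.
by field; rewrite gt_eqF ?expR_gt0.
Qed.

End gaussian_moments.

(** * Gaussian laws on arbitrary families of coordinates *)

Section sample_space.
Variables (R : realType) (I : choiceType).
Local Notation gauss := (normal_prob (0 : R) 1 : probability _ _).

(** These are the generators of [sample_sigma_algebra], for any index type: the measurability in
    [selector] becomes measurability on [sampleT] by conversion. *)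
Definition coordinate_sets : set (set (I -> R)) :=
  \bigcup_(i in [set: I])
    preimage_set_system setT (fun x : I -> R => x i) measurable.

Definition sampleT := g_sigma_algebraType coordinate_sets.

Lemma measurable_coord i : measurable_fun setT (fun x : sampleT => x i).
Proof.
move=> _ B mB; apply: sub_sigma_algebra; exists i => //.
by exists B.
Qed.

Lemma measurable_to_sample dT (T : measurableType dT) (f : T -> sampleT) :
  (forall i, measurable_fun setT (fun w => f w i)) -> measurable_fun setT f.
Proof.
move=> mf; apply: (@measurability _ _ _ _ setT f coordinate_sets) => //.
move=> _ [A [i _ [B mB <-]] <-]; rewrite !setTI.
by have := mf i measurableT _ mB; rewrite setTI.
Qed.

Definition cylinder (s : seq I) (B : I -> set R) : set sampleT :=
  \bigcap_(i in [set` s]) ((fun x : sampleT => x i) @^-1` B i).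

Lemma measurable_cylinder s B : (forall i, measurable (B i)) -> measurable (cylinder s B).
Proof.
move=> mB; apply: fin_bigcap_measurable; first exact: finite_seq.
move=> i _; rewrite -[X in measurable X]setTI; exact: measurable_coord.
Qed.

Lemma cylinder_unique (m1 m2 : {measure set sampleT -> \bar R}) :
  (m1 setT < +oo)%E ->
  (forall s B, uniq s -> (forall i, measurable (B i)) ->
    m1 (cylinder s B) = m2 (cylinder s B)) ->
  forall A, measurable A -> m1 A = m2 A.
Proof.
move=> fin1 m12.
pose G : set (set sampleT) :=
  [set C | exists s B, [/\ uniq s, forall i, measurable (B i) & C = cylinder s B]].
have G0 : G setT.
  exists [::], (fun=> setT); split => //.
  by apply/seteqP; split => // x _ i.
apply: (measure_unique G (fun=> setT)) => //.
- apply/seteqP; split.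
  + apply: smallest_sub; first exact: smallest_sigma_algebra.
    move=> _ [i _ [B mB <-]]; apply: sub_sigma_algebra.
    exists [:: i], (fun=> B); split => //; rewrite setTI.
    apply/seteqP; split => x /=.
      by move=> Bx j /=; rewrite inE => /eqP ->.
    by move=> /(_ i); apply; rewrite /= inE.
  + apply: smallest_sub; first exact: sigma_algebra_measurable.
    by move=> _ [s [B [us mB ->]]]; exact: measurable_cylinder.
- move=> _ _ [s [B [us mB ->]]] [t [C [ut mC ->]]].
  (* Cylinders over different lists meet in a cylinder over the merged list, each constraint being
     [setT] off its own list. *)
  exists (undup (s ++ t)), (fun i => (if i \in s then B i else setT) `&`
     (if i \in t then C i else setT)); split; first exact: undup_uniq.
  + by move=> i; apply: measurableI; case: ifP.
  + apply/seteqP; split => x /=.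
      move=> [Hs Ht] i /=; rewrite mem_undup mem_cat => _; split.
        by case: ifPn => // is_; exact: Hs.
      by case: ifPn => // it_; exact: Ht.
    move=> H; split => i /= ii.
      have /= := H i; rewrite mem_undup mem_cat ii /= => /(_ isT)[].
      by [].
    have /= := H i; rewrite mem_undup mem_cat ii orbT /= => /(_ isT)[].
    by [].
- by rewrite bigcup_const//; exists 0%N.
- by move=> _ [s [B [us mB ->]]]; exact: m12.
Qed.

(** Prescribing the finite cylinders determines the law, by [cylinder_unique]. *)
Definition iid_gaussian_law (m : probability sampleT R) :=
  forall s B, uniq s -> (forall i, measurable (B i)) ->
    m (cylinder s B) = (\prod_(i <- s) gauss (B i))%E.

Definition set_coord (j : I) (z : R) (x : sampleT) : sampleT :=
  fun i => if i == j then z else x i.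

Lemma measurable_set_coord j :
  measurable_fun setT (fun p : R * sampleT => set_coord j p.1 p.2).
Proof.
apply: measurable_to_sample => i; rewrite /set_coord; case: eqVneq => _.
  exact: (@measurable_fst _ _ R sampleT).
exact: (measurableT_comp (measurable_coord i) measurable_snd).
Qed.

Variables (m : probability sampleT R) (mE : iid_gaussian_law m).

(** Independence in the form that Tonelli needs: a coordinate may be replaced by a fresh Gaussian.
    On a cylinder that constrains [j], the fresh variable supplies the factor of [j]. *)
Lemma resample_coord j A : measurable A ->
  pushforward (gauss \x m)%E (fun p : R * sampleT => set_coord j p.1 p.2) A = m A.
Proof.
apply: (cylinder_unique (m1 := pushforward _ _)); first exact: measurable_set_coord.
  move=> ms.
  change ((gauss \x m)%E ((fun p : R * sampleT => set_coord j p.1 p.2) @^-1` setT) < +oo)%E.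
  rewrite (_ : _ @^-1` _ = setT `*` setT).
    by rewrite product_measure1E// [X in (X * _)%E]probability_setT
      [X in (_ * X)%E]probability_setT mule1 ltry.
  by apply/seteqP; split.
move=> ms s B us mB.
change ((gauss \x m)%E ((fun p : R * sampleT => set_coord j p.1 p.2) @^-1` cylinder s B)
  = m (cylinder s B)).
have [js|js] := boolP (j \in s); last first.
  rewrite (_ : _ @^-1` _ = setT `*` cylinder s B).
    rewrite product_measure1E//; last exact: measurable_cylinder.
    by rewrite [X in (X * _)%E]probability_setT mul1e.
  apply/seteqP; split => -[z x] /=.
    move=> H; split => // i /= si; have := H i si; rewrite /= /set_coord.
    by rewrite (negbTE (memPn js i si)).
  move=> [_ H] i /= si; rewrite /set_coord (negbTE (memPn js i si)).
  exact: H.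
rewrite (_ : _ @^-1` _ = B j `*` cylinder (rem j s) B).
  rewrite product_measure1E//; last exact: measurable_cylinder.
    rewrite [RHS]mE// (big_rem j)//=; congr (_ * _)%E; apply: mE => //.
    exact: rem_uniq.
  exact: mB.
apply/seteqP; split => -[z x] /=.
  move=> H; split; first by have := H j js; rewrite /= /set_coord eqxx.
  move=> i /=; rewrite mem_rem_uniq// inE => /andP[ij si].
  by have := H i si; rewrite /= /set_coord (negbTE ij).
move=> [Bz H] i /= si; rewrite /set_coord; have [->//|ij] := eqVneq i j.
by apply: H; rewrite /= mem_rem_uniq// inE ij.
Qed.

Lemma integral_resample j (H : sampleT -> \bar R) :
  measurable_fun setT H -> (forall x, 0 <= H x)%E ->
  (\int[m]_x H x = \int[m]_x \int[gauss]_z H (set_coord j z x))%E.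
Proof.
move=> mH H0.
have ms := measurable_set_coord j.
transitivity (\int[(gauss \x m)%E]_p H (set_coord j p.1 p.2))%E; last first.
  by rewrite fubini_tonelli2//; exact: measurableT_comp.
transitivity (\int[pushforward (gauss \x m)%E
    (fun p : R * sampleT => set_coord j p.1 p.2)]_x H x)%E.
  by apply: eq_measure_integral => A mA _; apply/esym/resample_coord.
by rewrite ge0_integral_pushforward.
Qed.

Definition shift_on (s : seq I) (a : I -> R) (x : sampleT) : sampleT :=
  fun i => x i + (if i \in s then a i else 0).

Lemma measurable_shift_on s a : measurable_fun setT (shift_on s a).
Proof.
apply: measurable_to_sample => i.
by apply: measurable_funD => //; exact: measurable_coord.
Qed.

Definition shift_density (a z : R) := expR (a * z - a ^+ 2 / 2).

Lemma measurable_shift_density a : measurable_fun setT (shift_density a).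
Proof.
apply: measurableT_comp => //.
by apply: measurable_funB => //; exact: measurable_funM.
Qed.

Lemma shift_density_ge0 a z : 0 <= shift_density a z.
Proof. exact: expR_ge0. Qed.

Lemma cameron_martin1 j a (H : sampleT -> \bar R) :
  measurable_fun setT H -> (forall x, 0 <= H x)%E ->
  (\int[m]_x H (shift_on [:: j] a x) =
   \int[m]_x (H x * (shift_density (a j) (x j))%:E))%E.
Proof.
move=> mH H0.
have mHs : measurable_fun setT (fun x => H (shift_on [:: j] a x)).
  exact: (measurableT_comp mH (measurable_shift_on [:: j] a)).
have md : measurable_fun setT (fun x : sampleT => (shift_density (a j) (x j))%:E).
  apply/measurable_EFinP.
  exact: (measurableT_comp (measurable_shift_density (a j)) (measurable_coord j)).
rewrite (integral_resample j)// [RHS](integral_resample j); last 2 first.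
- exact: emeasurable_funM.
- by move=> x; rewrite mule_ge0// lee_fin shift_density_ge0.
apply: eq_integral => x _.
have mz : measurable_fun setT (fun z => H (set_coord j z x)).
  apply: (measurableT_comp mH); apply: measurable_to_sample => i.
  by rewrite /set_coord; case: (i == j).
transitivity (\int[gauss]_z H (set_coord j (z + a j)%R x))%E.
  apply: eq_integral => z _; congr H; apply/funext => i.
  by rewrite /shift_on /set_coord inE; case: eqVneq => [->//|_]; rewrite addr0.
rewrite (ge0_integral_gauss_shift (a j) mz)//.
by apply: eq_integral => z _; rewrite /shift_density /set_coord eqxx.
Qed.

(** Coordinates are shifted one at a time. Because [s] has no repetition, the shift at [j] leaves
    the likelihood ratios of the remaining coordinates unchanged. *)
Lemma cameron_martin s (a : I -> R) (H : sampleT -> \bar R) :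
  uniq s -> measurable_fun setT H -> (forall x, 0 <= H x)%E ->
  (\int[m]_x H (shift_on s a x) =
   \int[m]_x (H x * (\prod_(i <- s) shift_density (a i) (x i))%:E))%E.
Proof.
elim: s H => [|j s IH] H us mH H0.
  apply: eq_integral => x _; rewrite big_nil mule1; congr H.
  by apply/funext => i; rewrite /shift_on in_nil addr0.
have /andP[js us'] := us.
have mprod t : measurable_fun setT
    (fun x : sampleT => (\prod_(i <- t) shift_density (a i) (x i))%:E).
  apply/measurable_EFinP; apply: measurable_prod => i _.
  exact: (measurableT_comp (measurable_shift_density (a i)) (measurable_coord i)).
have p0 t (x : sampleT) : (0 <= (\prod_(i <- t) shift_density (a i) (x i))%:E)%E.
  by rewrite lee_fin prodr_ge0// => i _; exact: shift_density_ge0.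
transitivity (\int[m]_x H (shift_on [:: j] a (shift_on s a x)))%E.
  apply: eq_integral => x _; congr H; apply/funext => i.
  rewrite /shift_on !inE -addrA; congr (_ + _).
  by have [->|_] := eqVneq i j; rewrite ?(negbTE js) ?add0r ?addr0.
rewrite (IH (fun x => H (shift_on [:: j] a x)))//; last first.
  exact: (measurableT_comp mH (measurable_shift_on [:: j] a)).
pose G x := (H x * (\prod_(i <- s) shift_density (a i) (x i))%:E)%E.
transitivity (\int[m]_x G (shift_on [:: j] a x))%E.
  apply: eq_integral => x _; rewrite /G; congr (_ * _%:E)%E.
  apply: eq_big_seq => i si; rewrite /shift_on inE.
  by rewrite (negbTE (memPn js i si)) addr0.
rewrite (cameron_martin1 j a); last 2 first.
- exact: emeasurable_funM.
- by move=> x; exact: mule_ge0.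
by apply: eq_integral => x _; rewrite /G big_cons -muleA -EFinM [(_ * \prod_(_ <- _) _)%R]mulrC.
Qed.

End sample_space.

(** * Mixtures over random signs and their relative entropy *)

Section sign_mixture.
Variables (R : realType) (I : choiceType) (n : nat).
Variables (loc : 'I_n -> I) (a : 'I_n -> R).
Hypothesis loc_inj : injective loc.
Local Notation gauss := (normal_prob (0 : R) 1 : probability _ _).
Local Notation S := (sampleT R I).

(** A sum of indicators instead of a lookup: it makes sense at every index and has the form of
    [block_mean], so that the contribution of one block can be split off. *)
Definition signed_shift (s : {ffun 'I_n -> bool}) (x : S) : S :=
  fun i => x i + \sum_j (i == loc j)%:R * ((-1) ^+ s j * a j).

Lemma signed_shiftE s : signed_shift s =
  shift_on (map loc (enum 'I_n)) (fun i => \sum_j (i == loc j)%:R * ((-1) ^+ s j * a j)).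
Proof.
apply/funext => x; apply/funext => i; rewrite /signed_shift /shift_on.
case: ifPn => // ni; rewrite big1// => j _.
case: eqVneq => [ij|_]; last by rewrite mul0r.
by case/negP: ni; rewrite ij; apply/mapP; exists j => //; rewrite mem_enum.
Qed.

Lemma measurable_signed_shift s : measurable_fun setT (signed_shift s).
Proof. by rewrite signed_shiftE; exact: measurable_shift_on. Qed.

(** Likelihood ratio of the even mixture of N(a j, 1) and N(- a j, 1) against N(0, 1). *)
Definition cosh_factor (j : 'I_n) (z : R) := expR (- (a j ^+ 2 / 2)) * cosh (a j * z).

Definition mixture_density (x : S) := \prod_j cosh_factor j (x (loc j)).

(** This is (y^2 + y tanh y) / 4. In this form the hyperbolic cosine of [cosh_factor] cancels the
    denominator and leaves [cosh_moment] to be integrated. *)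
Definition ln_cosh_majorant (y : R) := cosh_moment y / cosh y / 4.

Lemma ln_cosh_majorant_ge0 y : 0 <= ln_cosh_majorant y.
Proof. by rewrite !divr_ge0 ?cosh_moment_ge0// ltW// cosh_gt0. Qed.

Lemma measurable_ln_cosh_majorant : measurable_fun setT ln_cosh_majorant.
Proof.
apply: measurable_funM => //; apply: measurable_funM.
  exact: measurable_cosh_moment.
rewrite (_ : (fun x => _) = (fun x => expR (- ln (cosh x)))).
  apply: measurableT_comp => //; apply: measurableT_comp => //.
  exact: (measurableT_comp (@measurable_ln R) (@measurable_cosh R)).
by apply/funext => x; rewrite expRN lnK// posrE cosh_gt0.
Qed.

Lemma cosh_factor_gt0 j z : 0 < cosh_factor j z.
Proof. by rewrite mulr_gt0 ?expR_gt0 ?cosh_gt0. Qed.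

Lemma measurable_cosh_factor j : measurable_fun setT (cosh_factor j).
Proof.
apply: measurable_funM => //; apply: (measurableT_comp (@measurable_cosh R)).
exact: measurable_funM.
Qed.

Lemma measurable_coord_comp i (f : R -> R) : measurable_fun setT f ->
  measurable_fun setT (fun x : S => f (x i)).
Proof. by move=> mf; exact: (measurableT_comp mf (measurable_coord i)). Qed.

Lemma mixture_density_gt0 x : 0 < mixture_density x.
Proof. by rewrite prodr_gt0// => j _; exact: cosh_factor_gt0. Qed.

Lemma measurable_mixture_density : measurable_fun setT mixture_density.
Proof.
apply: measurable_prod => j _.
exact: measurable_coord_comp (measurable_cosh_factor j).
Qed.

Lemma sum_shift_density (x : S) :
  \sum_(s : {ffun 'I_n -> bool}) \prod_j shift_density ((-1) ^+ s j * a j) (x (loc j))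
  = 2 ^+ n * mixture_density x.
Proof.
rewrite -(bigA_distr_bigA (fun j (b : bool) => shift_density ((-1) ^+ b * a j) (x (loc j)))).
rewrite /mixture_density -[in 2 ^+ n](card_ord n) -prodr_const -big_split.
apply: eq_bigr => j _; rewrite big_bool /= /shift_density /cosh_factor /cosh expr0 expr1.
by rewrite mul1r mulN1r sqrrN !expRD mulNr; field.
Qed.

Lemma ln_mixture_density_le x :
  ln (mixture_density x) <=
  \sum_j (ln_cosh_majorant (a j * x (loc j)) - a j ^+ 2 / 2).
Proof.
have -> : ln (mixture_density x) = \sum_j ln (cosh_factor j (x (loc j))).
  apply: expR_inj; rewrite lnK ?posrE ?mixture_density_gt0// expR_sum.
  by apply: eq_bigr => j _; rewrite lnK// posrE cosh_factor_gt0.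
apply: ler_sum => j _; rewrite lnM ?posrE ?expR_gt0 ?cosh_gt0// expRK addrC lerD2r.
apply: le_trans (ln_cosh_le _) _; rewrite /ln_cosh_majorant /cosh_moment.
by rewrite ler_pM2r// mulrDl mulfK// gt_eqF// cosh_gt0.
Qed.

(* [L y <= L ln L - L + e^y], the Fenchel-Young inequality of the exponential. *)
Lemma young_mixture (y : R) x :
  mixture_density x * (y + 1 + \sum_j a j ^+ 2 / 2) <=
  mixture_density x * (\sum_j ln_cosh_majorant (a j * x (loc j))) + expR y.
Proof.
have L0 := mixture_density_gt0 x; set L := mixture_density x in L0 *.
have H := expR_ge1Dx (y - ln L).
rewrite expRD expRN lnK ?posrE// in H.
have K := ln_mixture_density_le x; rewrite sumrB -/L in K.
rewrite -(ler_pM2l L0) mulrCA divff ?gt_eqF// mulr1 in H.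
rewrite -(ler_pM2l L0) in K.
set v := \sum_j ln_cosh_majorant _ in K *; set c := \sum_j a j ^+ 2 / 2 in K *.
nra.
Qed.

Variables (m : probability S R) (mE : iid_gaussian_law m).

Lemma integral_signed_shift s (H : S -> \bar R) :
  measurable_fun setT H -> (forall x, 0 <= H x)%E ->
  (\int[m]_x H (signed_shift s x) =
   \int[m]_x (H x * (\prod_j shift_density ((-1) ^+ s j * a j) (x (loc j)))%:E))%E.
Proof.
move=> mH H0; rewrite signed_shiftE cameron_martin//; last first.
  by rewrite map_inj_uniq ?enum_uniq.
apply: eq_integral => x _; congr (_ * _%:E)%E.
rewrite big_map big_enum/=; apply: eq_bigr => j _; congr shift_density.
rewrite (bigD1 j)//= eqxx mul1r big1 ?addr0// => i ij.
by rewrite (inj_eq loc_inj) eq_sym (negbTE ij) mul0r.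
Qed.

Lemma sum_integral_signed_shift (H : S -> \bar R) :
  measurable_fun setT H -> (forall x, 0 <= H x)%E ->
  (\sum_(s : {ffun 'I_n -> bool}) \int[m]_x H (signed_shift s x) =
   (2 ^+ n)%:E * \int[m]_x (H x * (mixture_density x)%:E))%E.
Proof.
move=> mH H0.
have mL : measurable_fun setT (fun x => (mixture_density x)%:E).
  by apply/measurable_EFinP; exact: measurable_mixture_density.
under eq_bigr do rewrite integral_signed_shift//.
rewrite -ge0_integral_sum//; last 2 first.
- move=> s; apply: emeasurable_funM => //; apply/measurable_EFinP.
  by apply: measurable_prod => j _; apply: measurable_coord_comp; exact: measurable_shift_density.
- move=> s x _; rewrite mule_ge0// lee_fin prodr_ge0// => j _.
  exact: shift_density_ge0.
rewrite -ge0_integralZl//; last 2 first.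
- exact: emeasurable_funM.
- by move=> x _; rewrite mule_ge0// lee_fin ltW// mixture_density_gt0.
apply: eq_integral => x _; rewrite -ge0_sume_distrr; last first.
  by move=> s _; rewrite lee_fin prodr_ge0// => j _; exact: shift_density_ge0.
by rewrite sumEFin sum_shift_density EFinM muleCA.
Qed.

Lemma integral_mixture_density : (\int[m]_x (mixture_density x)%:E = 1)%E.
Proof.
have H := @sum_integral_signed_shift (cst 1%E) (measurable_cst _) (fun=> lee01).
have E1 : (\int[m]_x (cst 1%E x * (mixture_density x)%:E) = \int[m]_x (mixture_density x)%:E)%E.
  by apply: eq_integral => x _; rewrite mul1e.
have E2 (s : {ffun 'I_n -> bool}) : (\int[m]_x cst 1%E (signed_shift s x) = 1 :> \bar R)%E.
  by rewrite integral_cst// mul1e; exact: probability_setT.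
rewrite E1 (eq_bigr _ (fun s _ => E2 s)) in H.
have p2 : (2 ^+ n : R) != 0 by rewrite expf_neq0.
have := congr1 (fun e => (2 ^- n)%:E * e)%E H.
rewrite muleA -EFinM mulVf// mul1e => <-.
rewrite sumEFin sumr_const card_ffun card_bool card_ord -EFinM natrX mulVf//.
Qed.

Definition mixture_density_off j (x : S) := \prod_(i | i != j) cosh_factor i (x (loc i)).

Lemma mixture_density_off_gt0 j x : 0 < mixture_density_off j x.
Proof. by rewrite prodr_gt0// => i _; exact: cosh_factor_gt0. Qed.

Lemma measurable_mixture_density_off j : measurable_fun setT (mixture_density_off j).
Proof.
have -> : mixture_density_off j =
    (fun x => \prod_(i <- [seq i <- enum 'I_n | i != j]) cosh_factor i (x (loc i))).
  by apply/funext => x; rewrite big_filter big_enum_cond.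
apply: measurable_prod => i _.
exact: measurable_coord_comp (measurable_cosh_factor i).
Qed.

Lemma integral_coord_mixture_off j (f : R -> R) :
  measurable_fun setT f -> (forall z, 0 <= f z) ->
  (\int[m]_x (f (x (loc j)) * mixture_density x)%:E =
   \int[gauss]_z (f z * cosh_factor j z)%:E * \int[m]_x (mixture_density_off j x)%:E)%E.
Proof.
move=> mf f0.
have mfc : measurable_fun setT (fun z => (f z * cosh_factor j z)%:E).
  apply/measurable_EFinP; apply: measurable_funM => //; exact: measurable_cosh_factor.
have fc0 z : (0 <= (f z * cosh_factor j z)%:E)%E.
  by rewrite lee_fin mulr_ge0// ltW// cosh_factor_gt0.
have mfL : measurable_fun setT (fun x : S => (f (x (loc j)) * mixture_density x)%:E).
  apply/measurable_EFinP; apply: measurable_funM; first exact: measurable_coord_comp.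
  exact: measurable_mixture_density.
rewrite (integral_resample mE (loc j) mfL); last first.
  by move=> x; rewrite lee_fin mulr_ge0// ltW// mixture_density_gt0.
rewrite -ge0_integralZl//; last 3 first.
- by apply/measurable_EFinP; exact: measurable_mixture_density_off.
- by move=> x _; rewrite lee_fin ltW// mixture_density_off_gt0.
- exact: integral_ge0.
apply: eq_integral => x _; rewrite -ge0_integralZr//; last first.
  by rewrite lee_fin ltW// mixture_density_off_gt0.
apply: eq_integral => z _; rewrite -EFinM; congr EFin.
rewrite /mixture_density (bigD1 j)//= /set_coord eqxx mulrA; congr (_ * _).
by apply: eq_bigr => i ij; rewrite (inj_eq loc_inj) (negbTE ij).
Qed.

Lemma integral_coord_mixture j (f : R -> R) :
  measurable_fun setT f -> (forall z, 0 <= f z) ->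
  (\int[m]_x (f (x (loc j)) * mixture_density x)%:E =
   \int[gauss]_z (f z * cosh_factor j z)%:E)%E.
Proof.
move=> mf f0; rewrite integral_coord_mixture_off//.
(* For [f = 1] the left-hand side and the Gaussian factor are both 1, which forces the density of
   the other coordinates to have mass 1. *)
have := @integral_coord_mixture_off j (cst 1) (measurable_cst _) (fun=> ler01).
rewrite [LHS](_ : _ = 1%E); last first.
  rewrite -integral_mixture_density; apply: eq_integral => x _.
  by rewrite mul1r.
rewrite (_ : \int[gauss]_z _ = 1)%E ?mul1e; first by move=> <-; rewrite mule1.
transitivity (\int[gauss]_z ((expR (- (a j ^+ 2 / 2)))%:E * (cosh (a j * z))%:E))%E.
  by apply: eq_integral => z _; rewrite mul1r.
rewrite ge0_integralZl//; last 2 first.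
- apply/measurable_EFinP; apply: (measurableT_comp (@measurable_cosh R)).
  exact: measurable_funM.
- by move=> z _; rewrite lee_fin ltW// cosh_gt0.
by rewrite integral_gauss_cosh -EFinM -expRD addNr expR0.
Qed.

Lemma integral_majorant_mixture j :
  (\int[m]_x (ln_cosh_majorant (a j * x (loc j)) * mixture_density x)%:E <=
   (a j ^+ 2 / 2 + a j ^+ 4 / 4)%:E)%E.
Proof.
rewrite (@integral_coord_mixture j (fun z => ln_cosh_majorant (a j * z))); last 2 first.
- apply: (measurableT_comp measurable_ln_cosh_majorant); exact: measurable_funM.
- by move=> z; exact: ln_cosh_majorant_ge0.
rewrite [leLHS](_ : _ =
  \int[gauss]_z ((expR (- (a j ^+ 2 / 2)) / 4)%:E * (cosh_moment (a j * z))%:E))%E; last first.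
  apply: eq_integral => z _; rewrite -EFinM; congr EFin; rewrite /ln_cosh_majorant /cosh_factor.
  by field; rewrite gt_eqF// cosh_gt0.
rewrite ge0_integralZl//; last 2 first.
- apply/measurable_EFinP; apply: (measurableT_comp (@measurable_cosh_moment R)).
  exact: measurable_funM.
- by move=> z _; rewrite lee_fin cosh_moment_ge0.
apply: le_trans (lee_wpmul2l _ (integral_gauss_cosh_moment (a j))) _.
  by rewrite lee_fin divr_ge0 ?expR_ge0.
rewrite -EFinM lee_fin expRN le_eqVlt; apply/orP; left; apply/eqP.
by field; rewrite gt_eqF ?expR_gt0.
Qed.

(** The integrated form of [young_mixture], a Gibbs variational bound with tilt [lam] on [D]. The
    sums of [a j ^+ 2 / 2] on the two sides cancel, which leaves only fourth powers. *)
Lemma mixture_change_of_measure (lam : R) (D : set S) : measurable D -> 0 <= lam ->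
  lam * \sum_(s : {ffun 'I_n -> bool}) fine (m (signed_shift s @^-1` D)) <=
  2 ^+ n * (\sum_j a j ^+ 4 / 4 + (expR lam - 1) * fine (m D)).
Proof.
move=> mD lam0.
pose C := \sum_j a j ^+ 2 / 2.
have C0 : 0 <= C by rewrite sumr_ge0// => j _; rewrite divr_ge0 ?sqr_ge0.
have L0 x : 0 <= mixture_density x by rewrite ltW// mixture_density_gt0.
have mL := measurable_mixture_density.
have mInd : measurable_fun setT (\1_D : S -> R) by exact: measurable_indic.
have mV j : measurable_fun setT
    (fun x : S => ln_cosh_majorant (a j * x (loc j)) * mixture_density x).
  apply: measurable_funM => //.
  apply: (@measurable_coord_comp _ (fun z => ln_cosh_majorant (a j * z))).
  apply: (measurableT_comp measurable_ln_cosh_majorant); exact: measurable_funM.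
have V0 j (x : S) : 0 <= ln_cosh_majorant (a j * x (loc j)) * mixture_density x.
  by rewrite mulr_ge0// ln_cosh_majorant_ge0.
have lam1 : 0 <= expR lam - 1 by rewrite subr_ge0 -expR0 ler_expR.
pose mean : \bar R := (\int[m]_x (\1_D x * mixture_density x)%:E)%E.
have E1 : (\sum_(s : {ffun 'I_n -> bool}) m (signed_shift s @^-1` D) = (2 ^+ n)%:E * mean)%E.
  rewrite -(@sum_integral_signed_shift (fun x => (\1_D x)%:E)); last 2 first.
  - exact/measurable_EFinP.
  - by move=> x; rewrite lee_fin.
  apply: eq_bigr => s _.
  have := @integral_indic _ _ _ m setT measurableT (signed_shift s @^-1` D).
  rewrite setIT => <- //.
  by rewrite -[X in measurable X]setTI; exact: measurable_signed_shift.
have Epre s : m (signed_shift s @^-1` D) \is a fin_num.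
  apply: fin_num_measure.
  by rewrite -[X in measurable X]setTI; exact: measurable_signed_shift.
have ED : m D \is a fin_num by exact: fin_num_measure.
have key : (lam%:E * mean + (1 + C)%:E * 1 <=
   (\sum_j (a j ^+ 2 / 2 + a j ^+ 4 / 4))%:E + (1 + (expR lam - 1) * fine (m D))%:E)%E.
  have mIL : measurable_fun setT (fun x => \1_D x * mixture_density x).
    exact: measurable_funM.
  have IL0 x : 0 <= \1_D x * mixture_density x by rewrite mulr_ge0.
  have mSV : measurable_fun setT (fun x : S =>
      \sum_j ln_cosh_majorant (a j * x (loc j)) * mixture_density x).
    exact: measurable_sum.
  have SV0 (x : S) : 0 <= \sum_j ln_cosh_majorant (a j * x (loc j)) * mixture_density x.
    by rewrite sumr_ge0.
  have mX : measurable_fun setT (fun x : S => 1 + (expR lam - 1) * \1_D x).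
    by apply: measurable_funD => //; exact: measurable_funM.
  have X0 (x : S) : 0 <= 1 + (expR lam - 1) * \1_D x.
    by rewrite addr_ge0// mulr_ge0.
  have C1 : 0 <= 1 + C by rewrite addr_ge0.
  rewrite -integral_mixture_density -(ge0_integral_lincomb m mIL mL IL0 L0 lam0 C1).
  apply: (@le_trans _ _ (\int[m]_x
     (1 * (\sum_j ln_cosh_majorant (a j * x (loc j)) * mixture_density x)
     + 1 * (1 + (expR lam - 1) * \1_D x))%:E)%E).
    apply: ge0_le_integral => //.
    - by move=> x _; rewrite lee_fin addr_ge0// mulr_ge0.
    - by apply/measurable_EFinP/measurable_funD; exact: measurable_funM.
    - by apply/measurable_EFinP/measurable_funD; exact: measurable_funM.
    - move=> x _; rewrite lee_fin !mul1r.
      (* The tilt takes only the values 0 and [lam], so its exponential is affine in the indicator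
         and integrates to a multiple of [m D]. *)
      have -> : 1 + (expR lam - 1) * \1_D x = expR (lam * \1_D x).
        by rewrite indicE; case: (x \in D); rewrite ?mulr1 ?mulr0 ?expR0; ring.
      have Y := young_mixture (lam * \1_D x) x; rewrite -/C in Y.
      rewrite -mulr_suml [X in _ <= X + _]mulrC; apply: le_trans Y.
      by rewrite le_eqVlt; apply/orP; left; apply/eqP; ring.
  rewrite (ge0_integral_lincomb m mSV mX SV0 X0 ler01 ler01) !mul1e.
  apply: leeD.
    under eq_integral do rewrite -sumEFin.
    rewrite ge0_integral_sum//; last 2 first.
    - by move=> j; apply/measurable_EFinP.
    - by move=> j x _; rewrite lee_fin.
    by rewrite -sumEFin; apply: lee_sum => j _; exact: integral_majorant_mixture.
  rewrite [leLHS](_ : _ = \int[m]_x (1 * cst 1 x + (expR lam - 1) * \1_D x)%:E)%E; last first.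
    by apply: eq_integral => x _; rewrite mul1r.
  rewrite (@ge0_integral_lincomb _ _ _ m (cst 1) \1_D) //.
  have -> : (\int[m]_x (cst (1 : R) x)%:E = 1)%E.
    transitivity (\int[m]_x cst 1%E x)%E => //.
    by rewrite integral_cst// mul1e; exact: probability_setT.
  rewrite mul1e integral_indic// setIT.
  rewrite [X in (_ + _ * X <= _)%E](_ : _ = (fine (m D))%:E); last by rewrite fineK.
  by rewrite -EFinM -EFinD.
have meanfin : mean \is a fin_num.
  have : ((2 ^+ n)%:E * mean)%E \is a fin_num.
    by rewrite -E1; apply/sum_fin_numP => s _ _; exact: Epre.
  have mean0 : (0 <= mean)%E.
    by apply: integral_ge0 => x _; rewrite lee_fin mulr_ge0.
  case: mean mean0 {E1 key} => [r|_|]//.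
  by rewrite gt0_muley// lte_fin exprn_gt0.
have E2 : \sum_(s : {ffun 'I_n -> bool}) fine (m (signed_shift s @^-1` D)) = 2 ^+ n * fine mean.
  apply: EFin_inj; rewrite EFinM fineK// -E1 -sumEFin.
  by apply: eq_bigr => s _; rewrite fineK.
rewrite E2 mulrCA ler_pM2l ?exprn_gt0//.
move: key; rewrite -(fineK meanfin) -!EFinM -!EFinD lee_fin mulr1 big_split/= -/C.
lra.
Qed.

End sign_mixture.

(** * Averaging over finite configurations *)

Section update.
Variables (A T : finType).

Definition update (c : {ffun A -> T}) (i : A) (t : T) : {ffun A -> T} :=
  [ffun j => if j == i then t else c j].

(** Redrawing one entry of a uniform configuration leaves it uniform: exchanging the fresh value
    with the old one is an involution of the pairs. *)
Lemma sum_update (V : zmodType) (F : {ffun A -> T} -> V) (i : A) :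
  \sum_c \sum_t F (update c i t) = (\sum_c F c) *+ #|T|.
Proof.
rewrite pair_big /=.
pose sw (p : {ffun A -> T} * T) := (update p.1 i p.2, p.1 i).
have swK : involutive sw.
  move=> [c t]; rewrite /sw /=; congr pair; last by rewrite ffunE eqxx.
  by apply/ffunP => j; rewrite !ffunE; case: eqVneq => [->|].
rewrite (reindex_inj (inv_inj swK)) /=.
rewrite (eq_bigr (fun p => F p.1)); last first.
  move=> [c t] _ /=; congr F; apply/ffunP => j; rewrite !ffunE.
  by case: eqVneq => [->|].
rewrite -(pair_big xpredT xpredT (fun c _ => F c)) /= -sumrMnl.
by apply: eq_bigr => c _; rewrite sumr_const.
Qed.

End update.

Lemma exists_ge_mean (R : realDomainType) (T : finType) (f : T -> R) (x : R) :
  (0 < #|T|)%N -> x *+ #|T| <= \sum_t f t -> exists t, x <= f t.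
Proof.
move=> T0 H; apply/not_existsP => K.
have /card_gt0P[t0 _] := T0.
move: H; rewrite leNgt => /negP; apply.
rewrite -sumr_const; apply: ltr_sum; last by move=> t _; rewrite ltNge; apply/negP => /(K t).
by apply/hasP; exists t0; rewrite ?mem_index_enum.
Qed.

(** * The Fano bound in a single block *)

Section block.
Variables (R : realType) (I : choiceType) (n B : nat).
Variables (loc : 'I_B -> 'I_n -> I) (a : 'I_n -> R).
Local Notation S := (sampleT R I).
Variables (m : probability S R) (mE : iid_gaussian_law m).

(* Fano's inequality, by the change of measure with the tilt [ln B]. *)
Lemma fano_block (D : 'I_B -> set S) : (0 < B)%N ->
  (forall v, injective (loc v)) -> (forall v, measurable (D v)) ->
  trivIset setT D ->
  ln B%:R * (\sum_v \sum_(s : {ffun 'I_n -> bool})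
     fine (m (signed_shift (loc v) a s @^-1` D v))) <=
  2 ^+ n * (B%:R * (\sum_j a j ^+ 4 / 4) + B%:R).
Proof.
move=> B0 linj mD tD.
have lnB : 0 <= ln (B%:R : R) by rewrite ln_ge0// ler1n.
have B1 : 1 <= (B%:R : R) by rewrite ler1n.
rewrite [leLHS]mulr_sumr.
apply: (@le_trans _ _ (\sum_v 2 ^+ n * (\sum_j a j ^+ 4 / 4 + (B%:R - 1) * fine (m (D v))))).
  apply: ler_sum => v _.
  have := mixture_change_of_measure a (linj v) mE (mD v) lnB.
  by rewrite lnK// posrE ltr0n.
rewrite -mulr_sumr ler_pM2l ?exprn_gt0// big_split/= sumr_const card_ord mulr_natl lerD2l.
rewrite -mulr_sumr.
apply: (@le_trans _ _ ((B%:R - 1) * 1)); last by lra.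
rewrite ler_wpM2l ?subr_ge0//.
(* Disjointness enters here: the tilt weighs each null probability by [B - 1], and their total is at
   most 1 instead of [B]. *)
have U : (\sum_v m (D v) <= 1)%E.
  have <- := @measure_bigsetU_ord _ _ _ m _ xpredT D mD tD.
  by apply: probability_le1; apply: bigsetU_measurable => v _; exact: mD.
rewrite -lee_fin -sumEFin; apply: le_trans U; rewrite le_eqVlt; apply/orP; left.
by apply/eqP; apply: eq_bigr => v _; rewrite fineK//; exact: fin_num_measure.
Qed.

End block.

Lemma measurable_hamming_loss (R : realType) d (T : measurableType d) (K : finType)
    (est : T -> {ffun K -> bool}) (eta : {ffun K -> bool}) :
  (forall u, measurable [set x | est x u]) ->
  measurable_fun setT (fun x => (\sum_u (est x u != eta u))%N%:R : R).
Proof.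
move=> mest.
have mest1 u b : measurable [set x | est x u != b].
  case: b.
    rewrite (_ : [set x | _] = ~` [set x | est x u]); first exact: measurableC.
    by apply/seteqP; split => x /=; case: (est _ _).
  rewrite (_ : [set x | _] = [set x | est x u])//.
  by apply/seteqP; split => x /=; case: (est _ _).
rewrite (_ : (fun x => _) = (fun x => \sum_u \1_[set x | est x u != eta u] x)).
  by apply: measurable_sum => u; apply: measurable_indic; exact: mest1.
apply/funext => x; rewrite natr_sum; apply: eq_bigr => u _.
by rewrite indicE; congr (nat_of_bool _)%:R; apply/idP/idP; rewrite classical_sets.inE.
Qed.

(** * The Fano bound averaged over all blocks *)

Section fano.
Variables (R : realType) (I : choiceType) (K : finType) (n M B : nat).
Variables (block : 'I_M -> 'I_B -> K) (loc : K -> 'I_n -> I) (a : 'I_n -> R).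
Hypothesis block_inj : forall i v i' v', block i v = block i' v' -> i = i' /\ v = v'.
Hypothesis loc_inj : forall u, injective (loc u).
Local Notation S := (sampleT R I).
Variables (m : probability S R) (mE : iid_gaussian_law m).

Definition prior_index := {ffun 'I_M -> 'I_B * {ffun 'I_n -> bool}}.
Implicit Types c : prior_index.

Definition block_mean (i : 'I_M) (t : 'I_B * {ffun 'I_n -> bool}) (l : I) : R :=
  \sum_j (l == loc (block i t.1) j)%:R * ((-1) ^+ t.2 j * a j).

Definition prior_mean c (l : I) : R := \sum_i block_mean i (c i) l.

Definition prior_active c : {ffun K -> bool} :=
  [ffun u => [exists i, block i (c i).1 == u]].

(** Agreement on the whole block is required: the events for distinct [v] are then disjoint, and
    every unrecovered block contains a Hamming error. *)
Definition recovered (e : {ffun K -> bool}) i v :=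
  [forall w, e (block i w) == (w == v)].

Lemma prior_active_block c i w : prior_active c (block i w) = (w == (c i).1).
Proof.
rewrite ffunE; apply/existsP/eqP => [[j /eqP/block_inj[-> ->]]//|->].
by exists i.
Qed.

Lemma hamming_ge_unrecovered c (e : {ffun K -> bool}) :
  (\sum_i ~~ recovered e i (c i).1 <= \sum_u (e u != prior_active c u))%N.
Proof.
pose b (p : 'I_M * 'I_B) := block p.1 p.2.
have b_inj : injective b by move=> [i v] [i' v'] /block_inj /= [-> ->].
rewrite [leqRHS](bigID (mem [set b p | p in [set: 'I_M * 'I_B]%SET]%SET)) /=.
apply: leq_trans (leq_addr _ _).
rewrite big_imset/=; last by move=> p q _ _; exact: b_inj.
rewrite [leqRHS](_ : _ = \sum_i \sum_v
    (e (block i v) != prior_active c (block i v)))%N; last first.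
  by rewrite pair_big; apply: eq_bigl => p; rewrite finset.in_setT.
apply: leq_sum => i _; case: (boolP (recovered e i (c i).1)) => //.
rewrite negb_forall => /existsP[w ew].
by rewrite (bigD1 w)//= prior_active_block ew.
Qed.

Variables (est : S -> {ffun K -> bool}).
Hypothesis mest : forall u, measurable [set x | est x u].

Definition translate (h : I -> R) (x : S) : S := fun l => x l + h l.

Lemma measurable_translate h : measurable_fun setT (translate h).
Proof.
apply: measurable_to_sample => i.
by apply: measurable_funD => //; exact: measurable_coord.
Qed.

Definition recovery_event i v : set S := [set x | recovered (est x) i v].

Lemma measurable_recovery_event i v : measurable (recovery_event i v).
Proof.
rewrite (_ : recovery_event i v = \bigcap_(w in [set: 'I_B])
   (if w == v then [set x | est x (block i w)] else ~` [set x | est x (block i w)])).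
  apply: fin_bigcap_measurable => // w _; case: ifP => _ //.
  exact: measurableC.
apply/seteqP; split => x /=.
  by move=> /forallP H w _; have /eqP := H w; case: ifP => _ /= -> //.
move=> H; apply/forallP => w; have := H w Logic.I; case: ifP => _ /=.
  by move=> ->.
by move=> /negP/negbTE ->.
Qed.

Lemma measurable_translate_preimage h A : measurable A -> measurable (translate h @^-1` A).
Proof.
by move=> mA; rewrite -[X in measurable X]setTI; exact: measurable_translate.
Qed.

(** The other blocks act as a translation independent of [t], so they can be absorbed into the
    decision events of block [i]. *)
Lemma translate_update c i t : translate (prior_mean (update c i t)) =
  translate (fun l => \sum_(i' | i' != i) block_mean i' (c i') l)
    \o signed_shift (loc (block i t.1)) a t.2.
Proof.
apply/funext => x; apply/funext => l.
rewrite /translate /prior_mean /signed_shift /= (bigD1 i)//= addrA.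
rewrite {1}/update ffunE eqxx; congr (_ + _).
by apply: eq_bigr => j ji; rewrite ffunE (negbTE ji).
Qed.

Local Notation divergence := (\sum_j a j ^+ 4 / 4).

Lemma sum_recovery_le c i : (0 < B)%N ->
  ln B%:R * (\sum_t fine (m (translate (prior_mean (update c i t)) @^-1` recovery_event i t.1)))
  <= 2 ^+ n * (B%:R * divergence + B%:R).
Proof.
move=> B0; pose base l := \sum_(i' | i' != i) block_mean i' (c i') l.
have mD v : measurable (translate base @^-1` recovery_event i v).
  by apply: measurable_translate_preimage; exact: measurable_recovery_event.
have tD : trivIset setT (fun v => translate base @^-1` recovery_event i v).
  move=> v w _ _ [x [/= /forallP/(_ v)/eqP ev /forallP/(_ v)/eqP ew]].
  by move: ev; rewrite ew eqxx => /eqP.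
have := fano_block a mE B0 (fun v => @loc_inj (block i v)) mD tD.
apply: le_trans; rewrite pair_big/= le_eqVlt; apply/orP; left; apply/eqP.
by congr (_ * _); apply: eq_bigr => t _; rewrite translate_update.
Qed.

Definition recovery_prob c i : R :=
  fine (m (translate (prior_mean c) @^-1` recovery_event i (c i).1)).

(** By [sum_update] the average may be taken first over a fresh entry [i], where [sum_recovery_le]
    applies. The number [B * 2 ^+ n] of fresh entries cancels the factors of that bound. *)
Lemma sum_recovery_prob_le i : (1 < B)%N ->
  \sum_c recovery_prob c i <= (divergence + 1) / ln B%:R * #|{: prior_index}|%:R.
Proof.
move=> B1; have B0 : (0 < B)%N by exact: ltn_trans B1.
have lnB : 0 < ln (B%:R : R) by rewrite ln_gt0// ltr1n.
pose T := ('I_B * {ffun 'I_n -> bool})%type.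
have cT : #|{: T}|%:R = B%:R * 2 ^+ n :> R.
  by rewrite card_prod card_ord card_ffun card_bool card_ord natrM natrX.
have T0 : 0 < (#|{: T}|%:R : R).
  by rewrite cT mulr_gt0 ?exprn_gt0// ltr0n.
rewrite mulrAC ler_pdivlMr// -(ler_pM2l T0) mulrA mulr_natl
  -(sum_update (fun c => recovery_prob c i) i) mulrC mulr_sumr.
rewrite [leRHS](_ : _ = \sum_(c : prior_index) 2 ^+ n * (B%:R * divergence + B%:R)); last first.
  by rewrite sumr_const -[RHS]mulr_natr cT; ring.
apply: ler_sum => c _.
rewrite (eq_bigr (fun t =>
    fine (m (translate (prior_mean (update c i t)) @^-1` recovery_event i t.1)))).
  exact: sum_recovery_le.
by move=> t _; rewrite /recovery_prob {2}/update ffunE eqxx.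
Qed.

Lemma integral_hamming_ge c :
  ((\sum_i (1 - recovery_prob c i))%:E <=
    \int[m]_x ((\sum_u (est (translate (prior_mean c) x) u != prior_active c u))%N%:R)%:E)%E.
Proof.
pose h := prior_mean c.
pose miss i : set S := ~` (translate h @^-1` recovery_event i (c i).1).
have mG i : measurable (translate h @^-1` recovery_event i (c i).1).
  by apply: measurable_translate_preimage; exact: measurable_recovery_event.
have mmiss i : measurable (miss i) by exact: measurableC.
have -> : ((\sum_i (1 - recovery_prob c i))%:E = \int[m]_x (\sum_i \1_(miss i) x)%:E)%E.
  under eq_integral do rewrite -sumEFin.
  rewrite ge0_integral_sum//; last by move=> i; exact/measurable_EFinP/measurable_indic.
  rewrite -sumEFin; apply: eq_bigr => i _.
  transitivity (m (miss i)); last by rewrite integral_indic// setIT.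
  rewrite /miss probability_setC// EFinB fineK//.
  exact: fin_num_measure.
have mham : measurable_fun setT (fun x : S =>
    (\sum_u (est (translate h x) u != prior_active c u))%N%:R : R).
  apply: (measurable_hamming_loss (est := est \o translate h)) => u.
  exact: (measurable_translate_preimage h (mest u)).
apply: ge0_le_integral => //.
- by move=> x _; rewrite lee_fin sumr_ge0.
- by apply/measurable_EFinP/measurable_sum => i; exact: measurable_indic.
- exact/measurable_EFinP.
move=> x _; rewrite lee_fin.
apply: (@le_trans _ _ ((\sum_i ~~ recovered (est (translate h x)) i (c i).1)%N%:R)).
  rewrite natr_sum; apply: ler_sum => i _; rewrite indicE in_setC /=.
  by rewrite (_ : (x \in _) = recovered (est (translate h x)) i (c i).1)//; apply/idP/idP;
    rewrite classical_sets.inE.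
by rewrite ler_nat; exact: hamming_ge_unrecovered.
Qed.

Lemma fano_exists : (1 < B)%N ->
  exists c, ((M%:R * (1 - (divergence + 1) / ln B%:R))%:E <=
    \int[m]_x ((\sum_u (est (translate (prior_mean c) x) u != prior_active c u))%N%:R)%:E)%E.
Proof.
move=> B1; have B0 : (0 < B)%N by exact: ltn_trans B1.
have c0 : (0 < #|{: prior_index}|)%N.
  by apply/card_gt0P; exists [ffun=> (Ordinal B0, [ffun=> true])].
have [c Hc] : exists c, M%:R * (1 - (divergence + 1) / ln B%:R) <= \sum_i (1 - recovery_prob c i).
  apply: exists_ge_mean => //; rewrite exchange_big /=.
  rewrite [leLHS](_ : _ = \sum_(i < M)
      (1 - (divergence + 1) / ln B%:R) * #|{: prior_index}|%:R); last first.
    by rewrite sumr_const card_ord -mulr_natr -[RHS]mulr_natr; ring.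
  apply: ler_sum => i _; rewrite sumrB sumr_const mulrBl mul1r lerD2l lerN2.
  exact: sum_recovery_prob_le.
by exists c; apply: le_trans (integral_hamming_ge c).
Qed.

End fano.

(** * Unordered sums and truncation to finite support *)

Section nonneg_esum.
Variables (R : realType) (T : choiceType) (f : T -> R).
Hypothesis f0 : forall l, 0 <= f l.

Lemma esum_ge_seq (s : seq T) : uniq s ->
  ((\sum_(l <- s) f l)%:E <= \esum_(l in [set: T]) (f l)%:E)%E.
Proof.
move=> us; apply: esum_ge; exists [set` s]; first by split.
by rewrite -fsbig_seq// sumEFin.
Qed.

Lemma esum_approx_seq (x : R) : (x%:E < \esum_(l in [set: T]) (f l)%:E)%E ->
  exists2 s : seq T, uniq s & x < \sum_(l <- s) f l.
Proof.
move=> /ereal_sup_gt[_ [A [finA _] <-] xA].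
exists (finmap.enum_fset (fset_set A)); first exact: finmap.fset_uniq.
by rewrite -lte_fin -sumEFin -fsbig_finite.
Qed.

Lemma esum_finite_support (s : seq T) : uniq s -> (forall l, l \notin s -> f l = 0) ->
  (\esum_(l in [set: T]) (f l)%:E = (\sum_(l <- s) f l)%:E)%E.
Proof.
move=> us fs; transitivity (\esum_(l in [set` s]) (f l)%:E)%E.
  rewrite [RHS]esum_mkcond; apply: eq_esum => l _.
  case: ifPn => // ls; rewrite fs//; apply: contra ls => ls.
  by rewrite mem_setE.
rewrite esum_fset//; last by move=> l _; rewrite lee_fin.
by rewrite -fsbig_seq// sumEFin.
Qed.

End nonneg_esum.

Lemma ler_sum_subseq (R : realType) (T : eqType) (f : T -> R) (s s' : seq T) :
  (forall l, 0 <= f l) -> uniq s -> uniq s' -> {subset s <= s'} ->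
  \sum_(l <- s) f l <= \sum_(l <- s') f l.
Proof.
move=> f0 us us' ss'.
have P : perm_eq s' (s ++ [seq l <- s' | l \notin s]).
  apply: uniq_perm => //.
    rewrite cat_uniq us filter_uniq// andbT /=; apply/hasPn => l.
    by rewrite mem_filter => /andP[].
  move=> l; rewrite mem_cat mem_filter; case: (boolP (l \in s)) => //= /ss' ->.
  by [].
by rewrite (perm_big _ P) big_cat/= lerDl sumr_ge0.
Qed.

(* The mass lost by truncating is moved to the index [l0] of smallest weight. *)
Lemma finite_ellipsoid_truncation (R : realType) (T : choiceType) (w th : T -> R)
    (l0 : T) (r Q : R) :
  0 < w l0 -> (forall l, w l0 <= w l) ->
  (\esum_(l in [set: T]) (th l ^+ 2 * w l)%:E <= 1)%E ->
  ((r ^+ 2)%:E <= \esum_(l in [set: T]) (th l ^+ 2)%:E)%E ->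
  (\esum_(l in [set: T]) (th l ^+ 4)%:E < Q%:E)%E ->
  exists (s : seq T) (t : T -> R), [/\ uniq s, \sum_(l <- s) t l ^+ 2 * w l <= 1,
    r ^+ 2 <= \sum_(l <- s) t l ^+ 2 & \sum_(l <- s) t l ^+ 4 < Q].
Proof.
move=> w0 wmin H1 H2 H3.
have th2 l : 0 <= th l ^+ 2 by rewrite sqr_ge0.
have th4 l : 0 <= th l ^+ 4 by rewrite exprn_even_ge0.
have thw l : 0 <= th l ^+ 2 * w l by rewrite mulr_ge0// (le_trans (ltW w0)).
have S1 s : uniq s -> \sum_(l <- s) th l ^+ 2 * w l <= 1.
  by move=> us; rewrite -lee_fin; apply: le_trans H1; exact: esum_ge_seq.
have [q qQ S4] : exists2 q, q < Q & forall s, uniq s -> \sum_(l <- s) th l ^+ 4 <= q.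
  have qfin : (\esum_(l in [set: T]) (th l ^+ 4)%:E)%E \is a fin_num.
    rewrite ge0_fin_numE; first exact: lt_trans H3 (ltry _).
    by apply: esum_ge0 => l _; rewrite lee_fin.
  exists (fine (\esum_(l in [set: T]) (th l ^+ 4)%:E)%E).
    by rewrite -lte_fin fineK.
  by move=> s us; rewrite -lee_fin fineK//; exact: esum_ge_seq.
have S2 x : x < r ^+ 2 -> exists2 s : seq T, uniq s & x < \sum_(l <- s) th l ^+ 2.
  by move=> xr; apply: esum_approx_seq => //; apply: lt_le_trans H2; rewrite lte_fin.
set a := th l0 ^+ 2.
(* Raising the square at [l0] by [e] adds [2 * a * e + e ^+ 2] to the fourth powers; for
   [e <= rho <= 1] this is at most [rho * (2 * a + 1)], which is below the margin [Q - q]. *)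
pose rho := Num.min 1 ((Q - q) / (2 * a + 2)).
have a0 : 0 <= a by exact: th2.
have rho0 : 0 < rho by rewrite lt_min ltr01 divr_gt0 ?subr_gt0//; lra.
have rho1 : rho <= 1 by rewrite /rho ge_min lexx.
have rho2 : rho * (2 * a + 2) <= Q - q.
  by rewrite -ler_pdivlMr; [rewrite /rho ge_min lexx orbT|lra].
have [s1 us1 Hs1] : exists2 s : seq T, uniq s & r ^+ 2 - rho < \sum_(l <- s) th l ^+ 2.
  by apply: S2; lra.
pose s := undup (l0 :: s1).
have us : uniq s by exact: undup_uniq.
have l0s : l0 \in s by rewrite mem_undup inE eqxx.
have s1s : {subset s1 <= s} by move=> l ls; rewrite mem_undup inE ls orbT.
pose m := \sum_(l <- s) th l ^+ 2.
have Hm : r ^+ 2 - rho < m by apply: lt_le_trans Hs1 _; exact: ler_sum_subseq.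
pose e := Num.max 0 (r ^+ 2 - m).
have e0 : 0 <= e by rewrite /e le_max lexx.
have e1 : e <= rho by rewrite /e ge_max (ltW rho0)/=; lra.
have e2 : r ^+ 2 <= m + e by rewrite -lerBlDl /e le_max lexx orbT.
pose t l := if l == l0 then Num.sqrt (a + e) else th l.
have t2 : forall l, t l ^+ 2 = th l ^+ 2 + (l == l0)%:R * e.
  move=> l; rewrite /t; case: eqVneq => [->|_]; last by rewrite mul0r addr0.
  by rewrite sqr_sqrtr ?addr_ge0// mul1r.
have sum1 (g : T -> R) : \sum_(l <- s) (l == l0)%:R * g l = g l0.
  rewrite (bigD1_seq l0)//= eqxx mul1r big1 ?addr0// => l /negbTE ->.
  by rewrite mul0r.
exists s, t; split => //.
- have tw l : t l ^+ 2 * w l = th l ^+ 2 * w l + (l == l0)%:R * (e * w l).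
    by rewrite t2; ring.
  under eq_bigr do rewrite tw.
  rewrite big_split/= (sum1 (fun l => e * w l)).
  have [er|er] := leP (r ^+ 2 - m) 0.
    by rewrite /e max_l// mul0r addr0; exact: S1.
  (* The missing mass is charged at the lowest rate [w l0]. A larger list [s'], whose mass reaches
     [r ^+ 2] up to [x / w l0], pays at least as much for it up to [x], and still satisfies the
     budget 1. *)
  apply/ler_addgt0Pr => x x0.
  have [s2 us2 Hs2] : exists2 s' : seq T, uniq s' & r ^+ 2 - x / w l0 < \sum_(l <- s') th l ^+ 2.
    by apply: S2; rewrite ltrBlDr ltrDl divr_gt0.
  pose s' := undup (s ++ s2).
  have us' : uniq s' by exact: undup_uniq.
  have Hs' : r ^+ 2 - x / w l0 <= \sum_(l <- s') th l ^+ 2.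
    apply: (le_trans (ltW Hs2)); apply: ler_sum_subseq => // l ls.
    by rewrite mem_undup mem_cat ls orbT.
  have K : \sum_(l <- s) th l ^+ 2 * (w l - w l0) <= \sum_(l <- s') th l ^+ 2 * (w l - w l0).
    apply: ler_sum_subseq => //; first by move=> l; rewrite mulr_ge0// subr_ge0.
    by move=> l ls; rewrite mem_undup mem_cat ls.
  have split_sum (z : seq T) : \sum_(l <- z) th l ^+ 2 * (w l - w l0) =
      \sum_(l <- z) th l ^+ 2 * w l - (\sum_(l <- z) th l ^+ 2) * w l0.
    by rewrite mulr_suml -sumrB; apply: eq_bigr => l _; rewrite mulrBr.
  rewrite !split_sum -/m in K; have T1 := S1 _ us'.
  rewrite -(ler_pM2r w0) mulrBl divfK ?gt_eqF// in Hs'.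
  rewrite /e max_r; last exact: ltW.
  by rewrite mulrBl; lra.
- under eq_bigr do rewrite t2.
  by rewrite big_split/= (sum1 (fun=> e)).
- have t4 l : t l ^+ 4 = th l ^+ 4 + (l == l0)%:R * (2 * a * e + e ^+ 2).
    have -> : t l ^+ 4 = (t l ^+ 2) ^+ 2 by rewrite -exprM.
    rewrite t2; case: eqVneq => [->|_]; last by rewrite !mul0r !addr0 -exprM.
    by rewrite !mul1r /a; ring.
  under eq_bigr do rewrite t4.
  rewrite big_split/= (sum1 (fun=> _)).
  have := S4 _ us; have : e ^+ 2 <= e by rewrite expr2 ler_piMl//; lra.
  have : a * e <= a * rho by rewrite ler_wpM2l.
  lra.
Qed.

(** * Symmetry between k-sets and the lowest frequency *)

Lemma exists_bij_of_card (T : finType) (A B : {set T}) : #|A| = #|B| ->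
  exists2 g : T -> T, bijective g & forall y, (g y \in A) = (y \in B).
Proof.
move=> cAB.
pose E (C : {set T}) := enum C ++ enum (~: C).
have uE C : uniq (E C).
  rewrite cat_uniq !enum_uniq andbT /=; apply/hasPn => x.
  by rewrite !mem_enum finset.in_setC.
have mE C x : x \in E C.
  by rewrite mem_cat !mem_enum finset.in_setC; case: (x \in C).
have sE C : size (E C) = #|T| by rewrite size_cat -!cardE cardsC.
pose g C D y := nth y (E C) (index y (E D)).
have gK C D : cancel (g C D) (g D C).
  move=> y; rewrite /g index_uniq ?uE ?sE//.
    by rewrite nth_index.
  by rewrite -(sE D) index_mem.
exists (g A B); first by exists (g B A); exact: gK.
move=> y; rewrite /g nth_cat index_cat -cardE cAB mem_enum.
case: (boolP (y \in B)) => yB.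
  have lt : (index y (enum B) < #|B|)%N by rewrite cardE index_mem mem_enum.
  rewrite lt -mem_enum mem_nth// -cardE cAB//.
rewrite -cardE ltnNge leq_addr /= addKn; apply/negbTE.
have cC : #|~: A| = #|~: B|.
  by have := cardsC A; rewrite cAB -(cardsC B) => /addnI.
rewrite -finset.in_setC -mem_enum mem_nth// -cardE cC cardE index_mem mem_enum.
by rewrite finset.in_setC.
Qed.

(** The coefficients are symmetric in the coordinates, so a permutation carrying [v] onto [u]
    relabels frequencies at equal cost. A profile found for one k-set thus serves all of them. *)
Lemma freq_transport (R : realType) (sigma : R) (d : nat) (u v : {set 'I_d}) :
  #|u| = #|v| -> exists2 f : freq u -> freq v, injective f &
    forall l, ellipsoid_coef2 sigma (val (f l)) = ellipsoid_coef2 sigma (val l).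
Proof.
move=> /exists_bij_of_card[g [h gK hK] gE].
have P (l : freq u) : [forall j, ([ffun j => val l (g j)] j != 0 :> int) == (j \in v)].
  apply/forallP => j; rewrite ffunE -gE.
  by have /forallP/(_ (g j)) := valP l.
exists (fun l => @exist _ (fun l' : {ffun 'I_d -> int} =>
  is_true [forall j, (l' j != 0) == (j \in v)]) _ (P l)) => [l l' /(congr1 val) /= E|l].
  apply: val_inj; apply/ffunP => j.
  by have := congr1 (fun F : {ffun 'I_d -> int} => F (h j)) E; rewrite !ffunE hK.
rewrite /ellipsoid_coef2 [in RHS](reindex g); last by exists h => x _; rewrite ?gK ?hK.
by congr (_ `^ _); apply: eq_bigr => j _; rewrite /= ffunE.
Qed.

(** It receives the mass moved by the truncation. It is transparent because its entries are computed
    later. *)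
Definition lowest_freq (d : nat) (u : {set 'I_d}) : freq u.
Proof.
exists [ffun j => ((j \in u)%:R : int)].
by apply/forallP => j; rewrite ffunE; case: (j \in u).
Defined.

Lemma lowest_freq_coef2_gt0 (R : realType) (sigma : R) (d : nat) (u : {set 'I_d}) :
  (0 < #|u|)%N -> 0 < ellipsoid_coef2 sigma (val (lowest_freq u)).
Proof.
move=> /card_gt0P[j ju]; rewrite powR_gt0// (bigD1 j)//= ltr_pwDl//.
  by rewrite ffunE ju exprn_gt0// mulr1 mulr_gt0// pi_gt0.
by apply: sumr_ge0 => i _; rewrite sqr_ge0.
Qed.

Lemma lowest_freq_coef2_le (R : realType) (sigma : R) (d : nat) (u : {set 'I_d}) (l : freq u) :
  0 <= sigma -> ellipsoid_coef2 sigma (val (lowest_freq u)) <= ellipsoid_coef2 sigma (val l).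
Proof.
move=> s0; apply: ge0_ler_powR => //.
- by rewrite nnegrE sumr_ge0// => i _; rewrite sqr_ge0.
- by rewrite nnegrE sumr_ge0// => i _; rewrite sqr_ge0.
apply: ler_sum => j _; rewrite /= ffunE.
have /forallP/(_ j)/eqP := valP l.
case: (j \in u) => [lj|/negbFE/eqP ->] //.
rewrite mulr1 [leRHS]exprMn ler_peMr ?sqr_ge0// -rmorphXn /= ler1z.
by rewrite -gtz0_ge1 lt_neqAle sqr_ge0 andbT eq_sym sqrf_eq0.
Qed.

(** * The law of the noise on the sample space *)

Section noise_law.
Variables (R : realType) (disp : measure_display) (T : measurableType disp).
Variables (P : probability T R) (I : choiceType) (xi : I -> {RV P >-> R}).

Definition noise_path (w : T) : sampleT R I := fun i => xi i w.

Lemma measurable_noise_path : measurable_fun setT noise_path.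
Proof. by apply: measurable_to_sample => i; exact: measurable_funPT. Qed.

HB.instance Definition _ := isMeasurableFun.Build _ _ _ _ noise_path measurable_noise_path.

Definition noise_law : probability (sampleT R I) R := distribution P noise_path.

Lemma noise_law_gaussian : iid_standard_gaussian xi -> iid_gaussian_law noise_law.
Proof.
move=> [indep law] s B us mB.
transitivity (P (\bigcap_(i in [set` s]) (xi i @^-1` B i))) => //.
by rewrite indep//; apply: eq_bigr => i _; exact: law.
Qed.

Lemma expectation_noise_path (f : sampleT R I -> R) :
  measurable_fun setT f -> (forall x, 0 <= f x) ->
  ('E_P[f \o noise_path] = \int[noise_law]_x (f x)%:E)%E.
Proof.
move=> mf f0; rewrite unlock ge0_integral_pushforward//.
- exact/measurable_EFinP.
- by move=> x _; rewrite lee_fin.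
Qed.

End noise_law.

(** * The lower bound at a fixed noise level *)

Section minimax_lower_bound.
Variables (R : realType) (disp : measure_display) (T : measurableType disp).
Variables (P : probability T R) (d k : nat) (xi : obs_index d k -> {RV P >-> R}).
Hypothesis noise : iid_standard_gaussian xi.
Variables (beta sigma delta eps r : R) (eps_gt0 : 0 < eps).
Variables (n M B : nat) (loc : forall u : kset d k, 'I_n -> freq (val u)) (t : 'I_n -> R).
Hypothesis loc_inj : forall u, injective (loc u).
Hypothesis mass_weighted : forall u,
  \sum_j t j ^+ 2 * ellipsoid_coef2 sigma (val (loc u j)) <= 1.
Hypothesis mass : r ^+ 2 <= \sum_j t j ^+ 2.
Hypothesis B_gt1 : (1 < B)%N.
Variable block : 'I_M -> 'I_B -> kset d k.
Hypothesis block_inj : forall i v i' v', block i v = block i' v' -> i = i' /\ v = v'.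
Hypothesis class_card : forall eta : {ffun kset d k -> bool},
  nactive eta = M -> sparsity_class beta delta eta.

Definition flat_loc (u : kset d k) (j : 'I_n) : obs_index d k :=
  Tagged (fun u : kset d k => freq (val u)) (loc u j).

Lemma flat_loc_inj u : injective (flat_loc u).
Proof. by move=> i j /eqP; rewrite eq_Tagged => /eqP /loc_inj. Qed.

Local Notation config := (prior_index n M B).

(** The ellipsoid constraints, including the lower bound on the mass, also bind at inactive k-sets.
    These get the profile with plus signs, which [eta] hides from the data. *)
Definition sign_pattern (c : config) (u : kset d k) : {ffun 'I_n -> bool} :=
  if [pick i | block i (c i).1 == u] is Some i then (c i).2 else [ffun=> false].

Definition prior_parameter (c : config) : parameter R d k :=
  fun u l => \sum_j (l == loc u j)%:R * ((-1) ^+ sign_pattern c u j * t j).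

Lemma prior_parameter_loc c u j :
  prior_parameter c (loc u j) = (-1) ^+ sign_pattern c u j * t j.
Proof.
rewrite /prior_parameter (bigD1 j)//= eqxx mul1r big1 ?addr0// => i ij.
by rewrite (inj_eq (@loc_inj u)) eq_sym (negbTE ij) mul0r.
Qed.

Lemma prior_parameter_off c u l : l \notin map (loc u) (enum 'I_n) ->
  prior_parameter c l = 0.
Proof.
move=> nl; rewrite /prior_parameter big1// => j _.
case: eqVneq => [lj|_]; last by rewrite mul0r.
by case/negP: nl; rewrite lj; apply/mapP; exists j; rewrite ?mem_enum.
Qed.

Lemma prior_parameter_ellipsoid c : ellipsoids sigma r (prior_parameter c).
Proof.
move=> u.
have us : uniq (map (loc u) (enum 'I_n)) by rewrite (map_inj_uniq (@loc_inj u)) enum_uniq.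
have sq j : prior_parameter c (loc u j) ^+ 2 = t j ^+ 2.
  by rewrite prior_parameter_loc exprMn sqrr_sign mul1r.
have c0 (l : freq (val u)) : 0 <= ellipsoid_coef2 sigma (val l) by exact: powR_ge0.
split.
- rewrite (@esum_finite_support _ _ _ _ _ us).
  + rewrite lee_fin big_map big_enum/=.
    by under eq_bigr do rewrite sq; exact: mass_weighted.
  + by move=> l; rewrite mulr_ge0 ?sqr_ge0.
  + by move=> l /prior_parameter_off ->; rewrite expr0n/= mul0r.
- rewrite (@esum_finite_support _ _ _ _ _ us).
  + rewrite lee_fin big_map big_enum/=.
    by under eq_bigr do rewrite sq; exact: mass.
  + by move=> l; rewrite sqr_ge0.
  + by move=> l /prior_parameter_off ->; rewrite expr0n.
Qed.

Lemma nactive_prior_active (c : config) : nactive (prior_active block c) = M.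
Proof.
pose f i := block i (c i).1.
have f_inj : injective f by move=> i i' /block_inj[].
rewrite /nactive -[RHS]card_ord -(card_imset _ f_inj) -sum1_card [RHS]big_mkcond.
apply: eq_bigr => u _; rewrite ffunE.
rewrite (_ : [exists i, block i (c i).1 == u] = (u \in f @: 'I_M)) ; first by case: ifP.
by apply/existsP/imsetP => [[i /eqP <-]|[i _ ->]]; exists i.
Qed.

Lemma observation_prior (c : config) w :
  observation xi eps (prior_parameter c) (prior_active block c) w =
  (fun l => eps * translate (prior_mean block flat_loc (fun j => t j / eps) c) (noise_path xi w) l).
Proof.
have e0 : eps != 0 by rewrite gt_eqF.
apply/funext => -[u l]; rewrite /observation /translate /noise_path mulrDr addrC.
congr (_ + _); rewrite /= ffunE /prior_mean /block_mean /prior_parameter /sign_pattern.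
case: pickP => [i0 /eqP Ei|no]; last first.
  have -> : [exists i, block i (c i).1 == u] = false.
    by apply/existsP => -[i]; rewrite no.
  rewrite mul0r big1 ?mulr0// => i _; rewrite big1// => j _.
  rewrite /flat_loc -[X in _ == X]/(Tagged _ _) .
  case: eqP => [/(congr1 tag)/= E|_]; last by rewrite mul0r.
  by have := no i; rewrite -E eqxx.
have -> : [exists i, block i (c i).1 == u] by apply/existsP; exists i0; rewrite Ei.
rewrite mul1r (bigD1 i0)//= [X in _ + X]big1 ?addr0; last first.
  move=> i ii0; rewrite big1// => j _.
  case: eqP => [/(congr1 tag)/= E|_]; last by rewrite mul0r.
  by have := Ei; rewrite E => /block_inj[E' _]; rewrite E' eqxx in ii0.
rewrite mulr_sumr; apply: eq_bigr => j _.
(* With [u] replaced by the chosen member of its block, both indices have the same tag, and their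
   equality reduces to that of the frequencies. *)
move: l; rewrite -Ei => l.
rewrite /flat_loc eq_Tagged /=.
by field.
Qed.

Lemma minimax_risk_ge :
  (('C(d, k)%:R `^ (beta - 1) * (M%:R *
     (1 - (\sum_j (t j / eps) ^+ 4 / 4 + 1) / ln B%:R)))%:E
  <= minimax_risk xi beta sigma delta eps r)%E.
Proof.
apply: le_ereal_inf_tmp => _ [est mest <-].
(* The Fano bound is for unit noise with shifts [t j / eps]; the rescaling by [eps] is made part of
   the estimator. *)
pose est' (x : sampleT R (obs_index d k)) := est (fun l => eps * x l).
have mest' u : measurable [set x | est' x u].
  have ms : measurable_fun setT
      (fun x : sampleT R (obs_index d k) => (fun l => eps * x l) : sampleT R (obs_index d k)).
    apply: measurable_to_sample => i.
    by apply: measurable_funM => //; exact: measurable_coord.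
  rewrite -[X in measurable X]setTI.
  exact: (ms measurableT _ (mest u)).
have [c Hc] := fano_exists (fun j => t j / eps) block_inj flat_loc_inj
  (noise_law_gaussian noise) mest' B_gt1.
apply: le_trans (ereal_sup_ubound _); last first.
  by exists (prior_active block c) => //; apply: class_card; exact: nactive_prior_active.
apply: le_trans (ereal_sup_ubound _); last first.
  by exists (prior_parameter c) => //; exact: prior_parameter_ellipsoid.
rewrite EFinM; apply: lee_wpmul2l; first by rewrite lee_fin powR_ge0.
apply: le_trans Hc _; rewrite /hamming_risk.
rewrite -expectation_noise_path.
- rewrite le_eqVlt; apply/orP; left; apply/eqP; congr expectation.
  apply/funext => w /=; rewrite /hamming; congr (_%:R).
  by apply: eq_bigr => u _; rewrite observation_prior.
- apply: (@measurable_hamming_loss _ _ _ _ (est' \o translate _)) => u.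
  exact: (measurable_translate_preimage _ (mest' u)).
- by move=> x.
Qed.

End minimax_lower_bound.

(** * Numerical constants and the choice of blocks *)

Lemma fano_constants (R : realType) (N : nat) (beta c D : R) :
  0 < beta < 1 -> 0 <= c < beta -> 4 / (beta - c) <= ln N%:R -> D <= c * ln N%:R ->
  let M := Num.truncn ((N%:R : R) `^ (1 - beta)) in let B := (N %/ M)%N in
  [/\ (1 < B)%N, (M * B <= N)%N &
   (1 - c / beta) / 4 <= N%:R `^ (beta - 1) * (M%:R * (1 - (D + 1) / ln B%:R))].
Proof.
move=> /andP[b0 b1] /andP[c0 cb] LN DL M B.
set L := ln (N%:R : R) in LN DL.
have bc0 : 0 < beta - c by lra.
have L4 : 4 <= (beta - c) * L by rewrite mulrC -ler_pdivrMr.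
have L0 : 0 < L by apply: lt_le_trans LN; rewrite divr_gt0.
have bL : 4 <= beta * L by have := mulr_ge0 c0 (ltW L0); lra.
have N1 : 1 < (N%:R : R) by rewrite ltNge; apply/negP => /ln_le0; rewrite -/L; lra.
have N0 : 0 < (N%:R : R) by lra.
pose x := (N%:R : R) `^ (1 - beta).
have xE : x = expR ((1 - beta) * L) by rewrite /x /powR gt_eqF.
have yE : N%:R `^ (beta - 1) = x^-1.
  by rewrite xE -expRN /powR gt_eqF//; congr expR; rewrite /L; ring.
have NE : N%:R = expR L :> R by rewrite lnK.
have x1 : 1 <= x by rewrite xE -[leLHS]expR0 ler_expR mulr_ge0 ?(ltW L0)//; lra.
have x0 : 0 < x by lra.
have /andP[Mx xM] : M%:R <= x < M.+1%:R by apply: Num.Theory.truncn_itv; exact: ltW x0.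
have M0 : (0 < M)%N by rewrite -ltnS -(ltr_nat R); lra.
have MR : 1 <= (M%:R : R) by rewrite ler1n.
rewrite -natr1 in xM.
have xM2 : x <= 2 * M%:R by lra.
have e1 : expR 1 <= expR (beta * L) by rewrite ler_expR; lra.
have e4 : 4 < expR (beta * L).
  by apply: lt_le_trans (_ : 1 + beta * L <= _); [lra|exact: expR_ge1Dx].
have xb : N%:R = x * expR (beta * L) by rewrite xE -expRD NE; congr expR; ring.
have NB : (N%:R : R) < (B%:R + 1) * M%:R.
  rewrite natr1 -natrM ltr_nat mulnC {1}(divn_eq N M) mulnS addnC mulnC ltn_add2r.
  by rewrite ltn_mod.
have BE : expR (beta * L) < B%:R + 1.
  rewrite -(ltr_pM2l x0) -xb; apply: (lt_le_trans NB).
  by rewrite mulrC ler_wpM2r// addr_ge0.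
have B1 : (1 < B)%N by rewrite -(ltr_nat R); lra.
have BE2 : expR (beta * L) / 2 <= B%:R.
  have : 1 <= (B%:R : R) by rewrite ler1n ltnW.
  lra.
have B0 : 0 < (B%:R : R) by rewrite ltr0n ltnW.
(* The loss of 1 pays for the factor 1/2 in [BE2], since e >= 2. *)
have lB : beta * L - 1 <= ln B%:R.
  rewrite -ler_expR lnK ?posrE//; apply: le_trans BE2.
  rewrite expRD ler_wpM2l ?expR_ge0// expRN lef_pV2 ?posrE ?expR_gt0//.
  by apply: le_trans (expR_ge1Dx 1).
split => //; first by rewrite mulnC leq_divM.
rewrite yE mulrA.
have half : 1 / 2 <= x^-1 * M%:R.
  by rewrite [leRHS]mulrC ler_pdivlMr//; lra.
have lB0 : 0 < ln (B%:R : R) by lra.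
have cb1 : c / beta < 1 by rewrite ltr_pdivrMr// mul1r.
(* The bound is the midpoint of [c / beta] and 1. Clearing denominators asks for (beta - c) L >= 3 +
   c / beta, and 4 suffices because [c < beta]; this is the origin of the threshold on [ln N]. *)
have q : (D + 1) / ln B%:R <= (1 + c / beta) / 2.
  rewrite ler_pdivrMr//.
  have cb0 : 0 <= (1 + c / beta) / 2 by rewrite divr_ge0// addr_ge0// divr_ge0// ltW.
  apply: le_trans (ler_wpM2l cb0 lB).
  have -> : (1 + c / beta) / 2 * (beta * L - 1) = (beta * L + c * L) / 2 - (1 + c / beta) / 2.
    by field; rewrite gt_eqF.
  lra.
(* One factor 1/2 comes from rounding N^(1 - beta) down to [M], the other from the midpoint. *)
apply: (@le_trans _ _ (1 / 2 * ((1 - c / beta) / 2))); first by lra.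
by apply: ler_pM => //; lra.
Qed.

(** At fixed [k] this carries the growth of [d] over to the number of k-sets. *)
Lemma bin_ge_subn (d k : nat) : (1 <= k <= d)%N -> (d - k < 'C(d, k))%N.
Proof.
move=> /andP[k1 kd]; rewrite -{2}(subnK kd); move: (d - k)%N => m {kd}.
case: k k1 => // k _; elim: k => [|k IH]; first by rewrite addn1 bin1.
by rewrite addnS binS; apply: leq_trans IH _; rewrite leq_addl.
Qed.

Lemma card_kset d k : #|{: kset d k}| = 'C(d, k).
Proof.
rewrite card_sig -[d in RHS]card_ord -card_draws.
by apply: eq_card => u; rewrite !finset.inE.
Qed.

Lemma exists_blocks (K : finType) (M B : nat) : (M * B <= #|K|)%N ->
  exists block : 'I_M -> 'I_B -> K,
    forall i v i' v', block i v = block i' v' -> i = i' /\ v = v'.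
Proof.
move=> MB.
have lt (i : 'I_M) (v : 'I_B) : (i * B + v < #|K|)%N.
  apply: leq_trans MB; apply: (@leq_trans (i.+1 * B)); last by rewrite leq_mul2r ltn_ord orbT.
  by rewrite mulSn addnC ltn_add2r.
exists (fun i v => enum_val (Ordinal (lt i v))) => i v i' v' /enum_val_inj [E].
have B0 : (0 < B)%N by apply: leq_ltn_trans (ltn_ord v).
have Ei := congr1 (divn^~ B) E; have Ev := congr1 (modn^~ B) E.
rewrite /= !divnMDl// !divn_small// !addn0 in Ei.
rewrite /= !modnMDl !modn_small// in Ev.
by split; apply: val_inj.
Qed.

(** The hypothesis bounds the infimum of the sums of fourth powers by 4 q eps^4, and division by 4
    eps^4 returns [q]. The infimum need not be attained, hence the slack up to [q']. *)
Lemma detection_profile (R : realType) (sigma : R) (d k : nat) (u : {set 'I_d}) (eps r q : R) :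
  0 < sigma -> 0 < eps -> (0 < k)%N -> #|u| = k -> 0 <= q ->
  (detection sigma u eps r <= (Num.sqrt (2 * q))%:E)%E -> forall q', q < q' ->
  exists n (loc : forall v : kset d k, 'I_n -> freq (val v)) (t : 'I_n -> R),
    [/\ forall v, injective (loc v),
       forall v, \sum_j t j ^+ 2 * ellipsoid_coef2 sigma (val (loc v j)) <= 1,
       r ^+ 2 <= \sum_j t j ^+ 2 & \sum_j (t j / eps) ^+ 4 / 4 <= q'].
Proof.
move=> s0 e0 k0 uk q0 H q' qq'.
have e4 : 0 < eps ^+ 4 by rewrite exprn_gt0.
have D2 : (detection2 sigma u eps r < (2 * q')%:E)%E.
  move: H; rewrite /detection; case: (detection2 sigma u eps r) => [x||_]; last exact: ltNyr.
    rewrite poweR_EFin lee_fin lte_fin => H.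
    have [x0|x0] := leP 0 x; last by lra.
    rewrite powR12_sqrt// ler_sqrt in H; lra.
  (* The value +oo, as for an empty ellipsoid, contradicts the finite bound. *)
  by rewrite poweRyr ?invr_eq0// leye_eq.
have [_ [th thE <-] th4] : exists2 y, [set (\esum_(l in [set: freq u]) (th l ^+ 4)%:E)%E
    | th in @ellipsoid R sigma d u r] y & (y < (4 * q' * eps ^+ 4)%:E)%E.
  apply: ereal_inf_lt; rewrite ltNge; apply/negP => K.
  move: D2; rewrite ltNge => /negP; apply; rewrite /detection2.
  rewrite (_ : 2 * q' = (2 * eps ^+ 4)^-1 * (4 * q' * eps ^+ 4)).
    by rewrite EFinM lee_wpmul2l// lee_fin invr_ge0 mulr_ge0// ltW.
  by field; rewrite gt_eqF.
have u0 : (0 < #|u|)%N by rewrite uk.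
have [s [t [us t1 t2 t4]]] := @finite_ellipsoid_truncation R (freq u)
  (fun l => ellipsoid_coef2 sigma (val l)) th (lowest_freq u) r _
  (lowest_freq_coef2_gt0 sigma u0) (fun l => lowest_freq_coef2_le l (ltW s0)) thE.1 thE.2 th4.
have tr (v : kset d k) : {f : freq u -> freq (val v) | injective f /\
    forall l, ellipsoid_coef2 sigma (val (f l)) = ellipsoid_coef2 sigma (val l)}.
  apply: cid; have [|f fi fc] := @freq_transport R sigma d u (val v).
    by rewrite uk; apply/esym/eqP; exact: (valP v).
  by exists f.
have sumE (g : freq u -> R) : \sum_(j < size s) g (tnth (in_tuple s) j) = \sum_(l <- s) g l.
  by rewrite [RHS]big_tnth.
exists (size s), (fun v j => sval (tr v) (tnth (in_tuple s) j)), (fun j => t (tnth (in_tuple s) j)).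
split.
- move=> v i j /(svalP (tr v)).1.
  by move=> E; apply/val_inj/eqP; move: E; rewrite !(tnth_nth (lowest_freq u)) => /eqP;
    rewrite nth_uniq.
- move=> v; under eq_bigr do rewrite (svalP (tr v)).2.
  by rewrite (sumE (fun l => t l ^+ 2 * ellipsoid_coef2 sigma (val l))).
- by rewrite (sumE (fun l => t l ^+ 2)).
- rewrite (sumE (fun l => (t l / eps) ^+ 4 / 4)).
  rewrite [leLHS](_ : _ = (\sum_(l <- s) t l ^+ 4) / (4 * eps ^+ 4)).
    by rewrite ler_pdivrMr ?mulr_gt0// mulrA [q' * 4]mulrC ltW.
  by rewrite mulr_suml; apply: eq_bigr => l _; field; rewrite gt_eqF.
Qed.

(** * Passage to the limit in the noise level *)

Theorem theorem3 (R : realType) (beta sigma : R) (k : nat) (d : R -> nat)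
  (delta r : R -> R)
  (disp : R -> measure_display)
  (Omega : forall eps : R, measurableType (disp eps))
  (P : forall eps : R, probability (Omega eps) R)
  (xi : forall eps : R, obs_index (d eps) k -> {RV (P eps) >-> R})
  (u : forall eps : R, {set 'I_(d eps)})
  (beta_gt0 : 0 < beta) (beta_lt1 : beta < 1) (sigma_gt0 : 0 < sigma)
  (k_range : forall eps, 0 < eps -> (1 <= k <= d eps)%N)
  (d_infty : d eps @[eps --> 0^'+] --> \oo)
  (log_binom : (fun eps : R => ln 'C(d eps, k)%:R : R^o) =o_ (0^'+)
     (fun eps : R => eps `^ (- (2 * k%:R / (2 * sigma + k%:R))) : R^o))
  (delta_cvg0 : delta eps @[eps --> 0^'+] --> (0 : R))
  (delta_large : forall eps, 0 < eps ->
     forall eta : {ffun kset (d eps) k -> bool},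
     nactive eta = Num.truncn (('C(d eps, k)%:R : R) `^ (1 - beta)) ->
     sparsity_class beta (delta eps) eta)
  (r_range : forall eps, 0 < eps ->
     0 < r eps < (2 * pi) `^ (- sigma) * k%:R `^ (- (sigma / 2)))
  (noise : forall eps, 0 < eps -> iid_standard_gaussian (@xi eps))
  (u_card : forall eps, 0 < eps -> #|u eps| = k)
  (limsup_detection :
     (limf_esup (fun eps : R => detection sigma (u eps) eps (r eps) *
        (Num.sqrt (2 * ln 'C(d eps, k)%:R))^-1%:E) 0^'+ < (Num.sqrt beta)%:E)%E) :
  (0 < limf_einf (fun eps : R =>
         minimax_risk (@xi eps) beta sigma (delta eps) eps (r eps)) 0^'+)%E.

Proof.
have [V V0 Vlt] : exists2 V, (0^'+ : set_system R) V &
    (ereal_sup ((fun eps : R => detection sigma (u eps) eps (r eps) *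
        (Num.sqrt (2 * ln 'C(d eps, k)%:R))^-1%:E) @` V) < (Num.sqrt beta)%:E)%E.
  by have /ereal_inf_lt[_ [V V0 <-] Vlt] := limsup_detection; exists V.
have sb : 0 < Num.sqrt beta by rewrite sqrtr_gt0.
have [b [b0 bb bV]] : exists b, [/\ 0 <= b, b < Num.sqrt beta &
    forall eps, V eps -> (detection sigma (u eps) eps (r eps) *
        (Num.sqrt (2 * ln 'C(d eps, k)%:R))^-1%:E <= b%:E)%E].
  move: Vlt; set s := ereal_sup _ => Vlt.
  (* Clipping at 0 makes [b] nonnegative even for a supremum -oo, so that [b < Num.sqrt beta] can be
     squared. *)
  exists (Num.max 0 (fine s)); split.
  - by rewrite le_max lexx.
  - rewrite gt_max sb /=; move: Vlt; case: s => [x| |]//=.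
  - move=> eps Ve; apply: (@le_trans _ _ s).
      by apply: ereal_sup_ubound; exists eps.
    by move: Vlt; case: s => [x| |]//= _; rewrite ?lee_fin ?leNye// le_max lexx orbT.
have b2 : b ^+ 2 < beta.
  by rewrite -[ltRHS]sqr_sqrtr ?(ltW beta_gt0)// ltrXn2r.
(* The gap between [b ^+ 2] and [c] absorbs the unattained infimum; the gap between [c] and [beta]
   makes [kappa] positive. *)
pose c := (b ^+ 2 + beta) / 2.
have b20 : 0 <= b ^+ 2 by rewrite sqr_ge0.
have c0 : 0 <= c by rewrite /c; lra.
have cb : c < beta by rewrite /c; lra.
have b2c : b ^+ 2 < c by rewrite /c; lra.
pose L0 := 4 / (beta - c).
have L0_gt0 : 0 < L0 by rewrite divr_gt0//; lra.
have cbeta : c / beta < 1 by rewrite ltr_pdivrMr// mul1r.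
pose kappa := (1 - c / beta) / 4.
have kappa0 : 0 < kappa by rewrite /kappa; lra.
have large : \forall eps \near 0^'+, L0 <= ln ('C(d eps, k)%:R : R).
  (* The binomial coefficient then strictly exceeds [d - k], hence the truncation of [expR L0], and
     so is at least [expR L0]. *)
  have d_large := d_infty _ (nbhs_infty_ge (k + Num.truncn (expR L0))%N).
  near=> eps.
  have e0 : 0 < eps by near: eps; exact: nbhs_right_gt.
  have dk : (k + Num.truncn (expR L0) <= d eps)%N.
    by near: eps; exact: d_large.
  rewrite -ler_expR lnK; last by rewrite posrE ltr0n bin_gt0; case/andP: (k_range eps e0).
  apply: (@le_trans _ _ (Num.truncn (expR L0)).+1%:R).
    by apply/ltW/truncnS_gt.
  rewrite ler_nat; apply: leq_ltn_trans (bin_ge_subn (k_range eps e0)).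
  by rewrite leq_subRL// ; case/andP: (k_range eps e0).
have risk : \forall eps \near 0^'+,
    (kappa%:E <= minimax_risk (@xi eps) beta sigma (delta eps) eps (r eps))%E.
  near=> eps.
  have e0 : 0 < eps by near: eps; exact: nbhs_right_gt.
  have Ve : V eps by near: eps.
  have LN : L0 <= ln ('C(d eps, k)%:R : R) by near: eps.
  have lN0 : 0 < ln ('C(d eps, k)%:R : R) by exact: lt_le_trans LN.
  have /andP[k1 kd] := k_range eps e0.
  have Hdet : (detection sigma (u eps) eps (r eps) <=
      (Num.sqrt (2 * (b ^+ 2 * ln 'C(d eps, k)%:R)))%:E)%E.
    have s0 : 0 < Num.sqrt (2 * ln ('C(d eps, k)%:R : R)) by rewrite sqrtr_gt0 mulr_gt0.
    have := bV eps Ve; rewrite lee_pdivrMr// -EFinM.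
    rewrite [X in (_ <= X%:E)%E -> _](_ : _ = Num.sqrt (2 * (b ^+ 2 * ln 'C(d eps, k)%:R)))//.
    have -> : 2 * (b ^+ 2 * ln 'C(d eps, k)%:R) = b ^+ 2 * (2 * ln 'C(d eps, k)%:R) by ring.
    by rewrite [RHS]sqrtrM// sqrtr_sqr ger0_norm.
  have q0 : 0 <= b ^+ 2 * ln ('C(d eps, k)%:R : R) by rewrite mulr_ge0// ltW.
  have qc : b ^+ 2 * ln ('C(d eps, k)%:R : R) < c * ln 'C(d eps, k)%:R by rewrite ltr_pM2r.
  have [n [loc [t [linj mw mass div]]]] :=
    detection_profile sigma_gt0 e0 k1 (u_card eps e0) q0 Hdet qc.
  have [] := @fano_constants R 'C(d eps, k) beta c _ _ _ LN div.
  - by rewrite beta_gt0.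
  - by rewrite c0.
  set M := Num.truncn _; set B := (_ %/ _)%N => B1 MB K.
  have [block binj] := @exists_blocks (kset (d eps) k) M B
    (leq_trans MB (eq_leq (esym (card_kset _ _)))).
  apply: le_trans (minimax_risk_ge (noise eps e0) e0 linj mw mass B1 binj (delta_large eps e0)).
  by rewrite lee_fin.
rewrite limf_einfE.
apply: (@lt_le_trans _ _ kappa%:E); first by rewrite lte_fin.
apply: le_trans (ereal_sup_ubound _); last first.
  exists [set eps |
    (kappa%:E <= minimax_risk (@xi eps) beta sigma (delta eps) eps (r eps))%E] => //.
by apply: le_ereal_inf_tmp => _ [eps /= He <-].
Unshelve. all: by end_near.
Qed.
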